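(* Let $\Gamma$ be a metric graph of genus at least three without one valent points. Then the canonical map $\phi_{|K_\Gamma|}$ of $\Gamma$ is not injective if and only if the map $\Gamma\to\mathrm{Im}(\phi_{|K_\Gamma|})$ of metric graphs induced by the canonical map is not harmonic.
   Context: Metric graph: the underlying metric space of an edge-weighted graph $(G,l)$, where $G$ is a finite connected nonempty multigraph (loops allowed) and $l:E(G)\to\mathbb{R}_{>0}\cup\{\infty\}$ may take the value $\infty$ only on leaf edges (so all lengths are finite when there are no one valent points). Each edge $e$ is identified with $[0,l(e)]$. $(G,l)$ is called a model. The genus is the first Betti number. The valence $\mathrm{val}(x)$ is the number of half-edges of $x$, i.e. of connected components of $U\setminus\{x\}$ for a sufficiently small connected neighborhood $U$ of $x$. A divisor is an element $D=\sum D(x)\cdot x$ of the free abelian group on the points of $\Gamma$. The canonical divisor is $K_\Gamma=\sum_{x}(\mathrm{val}(x)-2)\cdot x$. A rational function is the constant $-\infty$ or a continuous piecewise linear function with integer slopes and finitely many pieces. For $f\not\equiv-\infty$, $\mathrm{div}(f)=\sum_x\mathrm{ord}_x(f)\cdot x$, with $\mathrm{ord}_x(f)$ the sum of outgoing slopes at $x$. $R(D)=\{f\not\equiv-\infty: D+\mathrm{div}(f)\ge0\}\cup\{-\infty\}$ is a finitely generated tropical semimodule over $\boldsymbol{T}=(\mathbb{R}\cup\{-\infty\},\oplus=\max,\odot=+)$ under pointwise operations. $\boldsymbol{TP}^{n-1}=(\boldsymbol{T}^{n}\setminus\{(-\infty,\dots,-\infty)\})/\sim$, where $\boldsymbol{x}\sim\boldsymbol{y}$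 iff $\boldsymbol{x}=\boldsymbol{y}+(\lambda,\dots,\lambda)$ for some real $\lambda$. The canonical map is $\phi_{|K_\Gamma|}(x)=(f_1(x):\cdots:f_n(x))\in\boldsymbol{TP}^{n-1}$ for a minimal generating set $\{f_1,\dots,f_n\}$ of $R(K_\Gamma)$ (unique up to order and additive constants). Lattice length: if $u\ne v$ have real coordinates and $(u_j-u_i)-(v_j-v_i)=\lambda w_j$ for all $j$, with $\lambda>0$ and $w$ an integer vector with entries of greatest common divisor $1$, their distance is $\lambda$ (independent of $i$). The image is regarded as a metric graph by giving the image of each segment on which all $f_i$ are linear its lattice length. Morphism: a continuous map $\varphi:\Gamma\to\Gamma'$ of metric graphs for which there are models $(G,l),(G',l')$ with $\varphi(V(G))\subset V(G')$, such that the inverse image of the relative interior of each edge of $G'$ is the union of relative interiors of finitely many edges of $G$, and $\varphi$ on each edge $e$ of $G$ is a dilation by an integer factor $\deg_e(\varphi)\ge0$; for a half-edge $h\subset e$, $\deg_h(\varphi)=\deg_e(\varphi)$. For $\Gamma'$ not a singleton, $\varphi$ is harmonic at $x$ if $\deg_x(\varphi)=\sum_h\deg_h(\varphi)$, summed over the half-edges $h$ of $x$ mapped to $h'$, is independent of the half-edge $h'$ emanating from $\varphi(x)$; $\varphi$ is harmonic if it is a morphism that is harmonic at all points. *)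

(* Defs.v *)
From HB Require Import structures.
From mathcomp Require Import all_boot all_order all_algebra.
From mathcomp Require Import all_classical all_reals all_analysis.
From mathcomp Require Import lra.
Set Implicit Arguments.
Unset Strict Implicit.
Unset Printing Implicit Defensive.
Import Order.TTheory GRing.Theory Num.Theory.
Import numFieldNormedType.Exports.
Local Open Scope classical_set_scope.
Local Open Scope ring_scope.

(* Edge-weighted graphs.  The length oo, allowed on leaf edges only, is left
   out: the corresponding metric graphs have one-valent points. *)
Record wgraph (R : realType) := WGraph {
  vertex : finType;
  edge : finType;
  src : edge -> vertex;
  tgt : edge -> vertex;
  len : edge -> R;
  len_gt0 : forall e, 0 < len e;
  wgraph_nonempty : (0 < #|vertex|)%N;
  wgraph_connected : forall u v : vertex,
    connect (fun a b => [exists e, ((src e == a) && (tgt e == b)) ||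
                                   ((src e == b) && (tgt e == a))]) u v }.

Section Chains.
Context {R : realType} {T : Type}.
Variable step : T -> T -> R -> Prop.

Inductive schain : T -> T -> R -> Prop :=
| chain_nil x : schain x x 0
| chain_cons x y z l m : step x y l -> schain y z m -> schain x z (l + m).

Definition chain_dist (x y : T) : R := inf [set l | schain x y l].

Lemma chain_cat x y z l m : schain x y l -> schain y z m -> schain x z (l + m).
Proof.
move=> c; elim: c z m => [u z m|u v w a b suv _ IH z m cz]; first by rewrite add0r.
by rewrite -addrA; apply: chain_cons suv _; exact: IH.
Qed.

Lemma chain_sym x y l : (forall u v m, step u v m -> step v u m) ->
  schain x y l -> schain y x l.
Proof.
move=> ss; elim=> [u|u v w a b suv _ IH]; first exact: chain_nil.
rewrite addrC; apply: chain_cat IH _; rewrite -[a]addr0.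
by apply: chain_cons (ss _ _ _ suv) _; exact: chain_nil.
Qed.

Lemma chain_ge0 x y l : (forall u v m, step u v m -> 0 <= m) ->
  schain x y l -> 0 <= l.
Proof.
by move=> ss; elim=> [//|u v w a b suv _ IH]; rewrite addr_ge0// (ss _ _ _ suv).
Qed.

End Chains.

Section Points.
Context {R : realType}.
Variable G : wgraph R.

(* A vertex, or an interior point of an edge e at distance t from src e. *)
Definition gpoint : Type :=
  (vertex G + {p : edge G * R | 0 < p.2 < len p.1})%type.

HB.instance Definition _ := Choice.copy gpoint
  (vertex G + {p : edge G * R | 0 < p.2 < len p.1})%type.

(* The identification of [0, len e] with the closed edge e. *)
Definition epar (e : edge G) (t : R) : gpoint :=
  if insub (e, t) is Some p then inr p
  else inl (if t <= 0 then src e else tgt e).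

(* The steps of the gluing metric of the disjoint union of the intervals [0, len e]. *)
Definition edge_step (x y : gpoint) (l : R) : Prop :=
  exists e a b, [/\ 0 <= a <= len e, 0 <= b <= len e,
    x = epar e a, y = epar e b & l = `|a - b|].

Definition gdist : gpoint -> gpoint -> R := chain_dist edge_step.

Variant epar_spec (e : edge G) (t : R) : gpoint -> Prop :=
| EparSrc of t = 0 : epar_spec e t (inl (src e))
| EparTgt of t = len e : epar_spec e t (inl (tgt e))
| EparIn (p : {p : edge G * R | 0 < p.2 < len p.1}) of
    sval p = (e, t) : epar_spec e t (inr p).

Lemma eparP e t : 0 <= t <= len e -> epar_spec e t (epar e t).
Proof.
move=> /andP[t0 tl]; rewrite /epar; case: insubP => [p _ pE|]; first exact: EparIn.
rewrite negb_and -!leNgt /= => /orP[t0'|tl'].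
  by rewrite t0'; apply: EparSrc; apply/eqP; rewrite eq_le t0 t0'.
have tE : t = len e by apply/eqP; rewrite eq_le tl tl'.
rewrite leNgt tE len_gt0 /=; exact: EparTgt.
Qed.

Lemma epar0 e : epar e 0 = inl (src e).
Proof. by rewrite /epar insubF /= ?ltxx// lexx. Qed.

Lemma epar1 e : epar e (len e) = inl (tgt e).
Proof. by rewrite /epar insubF /= ?ltxx ?andbF// leNgt len_gt0. Qed.

Lemma epar_inner (p : {p : edge G * R | 0 < p.2 < len p.1}) :
  epar (sval p).1 (sval p).2 = inr p.
Proof. by rewrite /epar -surjective_pairing valK. Qed.

Lemma edge_step_sym x y l : edge_step x y l -> edge_step y x l.
Proof.
by move=> [e [a [b [ha hb -> -> ->]]]]; exists e, b, a; split=> //; rewrite distrC.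
Qed.

Lemma edge_step_ge0 x y l : edge_step x y l -> 0 <= l.
Proof. by move=> [e [a [b [_ _ _ _ ->]]]]. Qed.

Lemma chain_to_vertex x : exists v l, schain edge_step x (inl v) l.
Proof.
case: x => [v|p]; first by exists v, 0; exact: chain_nil.
exists (src (sval p).1), (`|(sval p).2 - 0| + 0); apply: chain_cons (chain_nil _ _).
exists (sval p).1, (sval p).2, 0; have /andP[p0 pl] := svalP p.
by split; rewrite ?epar_inner ?epar0 ?lexx ?(ltW p0) ?(ltW pl) ?(ltW (len_gt0 _)).
Qed.

Lemma chain_vertices u v : exists l, schain edge_step (inl u) (inl v) l.
Proof.
have /connectP[p + ->] := wgraph_connected u v.
elim: p u => [u _|w p IH u /= /andP[/existsP[e ew] /IH[l cl]]].
  by exists 0; exact: chain_nil.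
exists (`|0 - len e| + l); apply: chain_cons cl.
have l0 := ltW (len_gt0 e).
case/orP: ew => /andP[/eqP <- /eqP <-]; last apply: edge_step_sym;
  by exists e, 0, (len e); split; rewrite ?epar0 ?epar1 ?lexx ?l0.
Qed.

Lemma chain_exists x y : exists l, schain edge_step x y l.
Proof.
have [u [l xu]] := chain_to_vertex x; have [v [m yv]] := chain_to_vertex y.
have [k uv] := chain_vertices u v; exists (l + (k + m)).
by apply: chain_cat xu (chain_cat uv (chain_sym edge_step_sym yv)).
Qed.

Lemma chain_lbound x y : has_lbound [set l : R | schain edge_step x y l].
Proof. by exists 0 => l /(chain_ge0 edge_step_ge0). Qed.

Lemma gdist_le x y l : schain edge_step x y l -> gdist x y <= l.
Proof. by move=> c; apply: ge_inf => //; exact: chain_lbound. Qed.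

Lemma gdist_ge x y m : (forall l, schain edge_step x y l -> m <= l) ->
  m <= gdist x y.
Proof.
move=> h; apply: lb_le_inf; first by have [l ?] := chain_exists x y; exists l.
by move=> l /h.
Qed.

Lemma gdistxx x : gdist x x = 0.
Proof.
apply/eqP; rewrite eq_le gdist_le ?gdist_ge//; last exact: chain_nil.
by move=> l /(chain_ge0 edge_step_ge0).
Qed.

Lemma gdist_sym x y : gdist x y = gdist y x.
Proof.
suff h u v : gdist u v <= gdist v u by apply/eqP; rewrite eq_le !h.
by apply: gdist_ge => l /(chain_sym edge_step_sym)/gdist_le.
Qed.

Lemma gdist_triangle y x z : gdist x z <= gdist x y + gdist y z.
Proof.
rewrite -lerBlDr; apply: gdist_ge => l xy; rewrite lerBlDr -lerBlDl.
by apply: gdist_ge => m yz; rewrite lerBlDl gdist_le//; exact: chain_cat yz.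
Qed.

Lemma gdist_lip (g : gpoint -> R) x y :
  (forall e a b, 0 <= a <= len e -> 0 <= b <= len e ->
     g (epar e a) - g (epar e b) <= `|a - b|) ->
  g x - g y <= gdist x y.
Proof.
move=> lip; apply: gdist_ge => l; elim=> [u|u v w a b [e [s [t [hs ht -> -> ->]]]] _ IH].
  by rewrite subrr.
by have := lip e s t hs ht; lra.
Qed.

Lemma gdist_eq0_inner (p : {p : edge G * R | 0 < p.2 < len p.1}) y :
  gdist (inr p) y = 0 -> inr p = y.
Proof.
move=> d0; apply: contrapT => py; case: p py d0 => -[e0 t0] pt py d0.
have /andP[/= t00 t0l] := pt.
pose r := Num.min t0 (len e0 - t0).
have r0 : 0 < r by rewrite lt_min t00 subr_gt0 t0l.
have rt : r <= t0 by rewrite ge_min lexx.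
have rl : r <= len e0 - t0 by rewrite ge_min lexx orbT.
pose bump (e : edge G) (t : R) := if e == e0 then Num.max 0 (r - `|t - t0|) else 0.
pose g (z : gpoint) := if z is inr q then bump (sval q).1 (sval q).2 else 0.
have gE e t : 0 <= t <= len e -> g (epar e t) = bump e t.
  move=> ht; case: (eparP ht) => [->|->|q qE]; last by rewrite /g qE.
    rewrite /g /bump; case: eqP => // _; rewrite max_l// sub0r normrN gtr0_norm//.
    by rewrite subr_le0.
  rewrite /g /bump; case: eqP => // ->; rewrite max_l//.
  by rewrite gtr0_norm ?subr_gt0// subr_le0.
have: g (inr (exist _ (e0, t0) pt)) - g y <= 0.
  rewrite -[leRHS]d0; apply: gdist_lip => e a b ha hb.
  rewrite !gE// /bump; case: eqP => _; last by rewrite subrr.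
  have := ler_normB (a - t0) (a - b); rewrite (_ : a - t0 - (a - b) = b - t0); last by lra.
  have := normr_ge0 (a - b).
  by rewrite /Num.max; case: ltP => ?; case: ltP => ?; lra.
apply/negP; rewrite -ltNge subr_gt0.
rewrite [ltRHS]/g /bump /= eqxx subrr normr0 subr0 max_r ?(ltW r0)//.
case: y py {d0} => [v|[[e t] /= q]] py //=; rewrite /bump; case: eqP => // ee.
rewrite gt_max r0 /= ltrBlDr ltrDl normr_gt0 subr_eq0; apply/eqP => tt.
by apply: py; congr inr; apply: val_inj => /=; rewrite ee tt.
Qed.

Lemma lipschitz_max (a b c d l : R) :
  a - c <= l -> b - d <= l -> Num.max a b - Num.max c d <= l.
Proof. by move=> ac bd; case: (leP a b) => ?; case: (leP c d) => ?; lra. Qed.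

Lemma gdist_eq0_vertex v y : gdist (inl v) y = 0 -> inl v = y.
Proof.
move=> d0; apply: contrapT => vy.
pose r := \big[Num.min/1]_(e : edge G) len e.
have r0 : 0 < r.
  rewrite /r; elim/big_ind: _ => [//|a b a0 b0|e _]; last exact: len_gt0.
  by rewrite lt_min a0 b0.
have rl (e : edge G) : r <= len e by apply/bigmin_leP; right; exists e.
pose bump (w : vertex G) (t : R) := if w == v then r - t else 0.
pose h (e : edge G) (t : R) :=
  Num.max 0 (Num.max (bump (src e) t) (bump (tgt e) (len e - t))).
pose g (z : gpoint) : R :=
  match z with
  | inl w => if w == v then r else 0
  | inr q => h (sval q).1 (sval q).2
  end.
have gE e t : 0 <= t <= len e -> g (epar e t) = h e t.
  move=> ht; have := rl e; rewrite -subr_le0 => rle.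
  case: (eparP ht) => [->|->|q qE]; last by rewrite /g qE.
    rewrite /g /h /bump !subr0; case: eqP => _; case: eqP => _;
    by rewrite ?maxxx ?[Num.max r _]max_l ?(le_trans rle) ?(max_r (ltW r0))
      ?[Num.max 0 (r - _)]max_l ?maxxx ?(ltW r0).
  rewrite /g /h /bump subrr !subr0; case: eqP => _; case: eqP => _;
  by rewrite ?maxxx ?[Num.max _ r]max_r ?(le_trans rle) ?(max_r (ltW r0))
    ?[Num.max (r - _) 0]max_r ?maxxx ?(ltW r0).
have: g (inl v) - g y <= 0.
  rewrite -[leRHS]d0; apply: gdist_lip => e a b ha hb.
  rewrite !gE//; have ab := ler_norm (a - b); have := ler_norm (b - a).
  rewrite (distrC b a) => ba; rewrite /h /bump.
  by do 2 (apply: lipschitz_max; rewrite ?subrr//); case: eqP => _; lra.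
apply/negP; rewrite -ltNge subr_gt0 [ltRHS]/g eqxx.
case: y vy {d0} => [w|[[e t] /= q]] vy /=.
  by case: eqP => // wv; case: vy; rewrite wv.
have /andP[/= t0 tl] := q.
by rewrite /h /bump !gt_max r0 /=; apply/andP; split; case: eqP => _; lra.
Qed.

Lemma gdist_positivity x y : gdist x y = 0 -> x = y.
Proof. by case: x => [v|p]; [exact: gdist_eq0_vertex|exact: gdist_eq0_inner]. Qed.

HB.instance Definition _ := @isMetric.Build R gpoint gdist gdistxx
  gdist_positivity gdist_sym gdist_triangle.

End Points.

Section Graphs.
Context {R : realType}.
Variable G : wgraph R.

Definition boundary_mx : 'M[rat]_(#|edge G|, #|vertex G|) :=
  \matrix_(i, j) ((tgt (enum_val i) == enum_val j)%:R -
                  (src (enum_val i) == enum_val j)%:R).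

(* The dimension of H_1, i.e. of the space of rational cycles. *)
Definition genus : nat := \rank (kermx boundary_mx).

(* A half-edge leaves its base point along an edge, towards tgt (false) or
   towards src (true).  A loop at v gives two half-edges of v. *)
Definition half_edges (x : gpoint G) : {set edge G * bool} :=
  match x with
  | inl v => [set h | (if h.2 then tgt h.1 else src h.1) == v]
  | inr p => [set h | h.1 == (sval p).1]
  end.

Definition valence (x : gpoint G) : nat := #|half_edges x|.

(* The point at distance s from x in the direction h, for s small. *)
Definition ray (x : gpoint G) (h : edge G * bool) (s : R) : gpoint G :=
  let t0 := match x with
            | inl _ => if h.2 then len h.1 else 0
            | inr p => (sval p).2
            end in
  epar h.1 (if h.2 then t0 - s else t0 + s).

Record divisor := Divisor {
  coef :> gpoint G -> int;
  coef_finite : finite_set [set x | coef x != 0] }.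

Lemma canonical_divisor_finite :
  finite_set [set x : gpoint G | (valence x)%:Z - 2 != 0].
Proof.
apply: (@sub_finite_set _ _ (inl @` [set: vertex G])); last exact/finite_image.
move=> [v|p] /=; first by exists v.
rewrite /valence (_ : half_edges _ = [set ((sval p).1, true); ((sval p).1, false)]%SET).
  by rewrite cards2 xpair_eqE eqxx.
by apply/setP => -[e []]; rewrite !inE /= !xpair_eqE ?andbT ?andbF ?orbF.
Qed.

Definition canonical_divisor : divisor := Divisor canonical_divisor_finite.

(* Affineness on closed pieces makes g continuous. *)
Definition pw_linear (g : gpoint G -> R) : Prop :=
  forall e, exists2 s : seq R, itv_partition 0 (len e) s &
    forall k, (k < size s)%N -> exists m : int,
      forall t, nth 0 (0 :: s) k <= t <= nth 0 s k ->
        g (epar e t) =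
        g (epar e (nth 0 (0 :: s) k)) + m%:~R * (t - nth 0 (0 :: s) k).

Definition outgoing_slope (g : gpoint G -> R) (x : gpoint G)
    (h : edge G * bool) : int :=
  xget 0 [set m : int | \forall s \near 0^'+, g (ray x h s) = g x + m%:~R * s].

Definition ord_at (g : gpoint G -> R) (x : gpoint G) : int :=
  \sum_(h in half_edges x) outgoing_slope g x h.

(* R(D); the tropical semifield is \bar R without +oo. *)
Definition linear_system (D : divisor) : set (gpoint G -> \bar R) :=
  [set cst -oo%E] `|`
  [set EFin \o g | g in [set g | pw_linear g /\ forall x, 0 <= D x + ord_at g x]].

Definition generates (M : set (gpoint G -> \bar R)) n
    (f : 'I_n -> gpoint G -> \bar R) (J : {set 'I_n}) : Prop :=
  (forall j, j \in J -> M (f j)) /\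
  forall g, M g -> exists c : 'I_n -> \bar R,
    (forall j, c j != +oo%E) /\
    forall x, g x = \big[maxe/-oo%E]_(j in J) (c j + f j x)%E.

Definition minimal_generating_set (M : set (gpoint G -> \bar R)) n
    (f : 'I_n -> gpoint G -> \bar R) : Prop :=
  generates M f [set: 'I_n]%SET /\
  forall J, generates M f J -> J = [set: 'I_n]%SET.

End Graphs.

Section Projective.
Context {R : realType} {n : nat}.

(* The point (u_1 : ... : u_n) of tropical projective space, as an equivalence
   class. *)
Definition tproj (u : 'I_n -> \bar R) : set ('I_n -> \bar R) :=
  [set v | exists l : R, forall j, u j = (v j + l%:E)%E].

Definition lattice_length (p q : set ('I_n -> \bar R)) (l : R) : Prop :=
  0 < l /\
  exists u v : 'I_n -> R,
    [/\ p = tproj (EFin \o u), q = tproj (EFin \o v) &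
        exists i (w : 'I_n -> int),
          \big[gcdn/0%N]_j `|w j|%N = 1%N /\
          forall j, (u j - u i) - (v j - v i) = l * (w j)%:~R].

End Projective.

Section CanonicalMap.
Context {R : realType} {G : wgraph R} {n : nat}.
Variable f : 'I_n -> gpoint G -> \bar R.

(* The members of a minimal generating set are never the constant -oo, so for
   them this is a point of tropical projective space. *)
Definition projective_map (x : gpoint G) : set ('I_n -> \bar R) :=
  tproj (fun j => f j x).

Definition linear_on (e : edge G) (a b : R) : Prop :=
  forall j, exists c m : R, forall t, Num.min a b <= t <= Num.max a b ->
    f j (epar e t) = (c + m * t)%:E.

Definition image_step (p q : set ('I_n -> \bar R)) (l : R) : Prop :=
  exists e a b,
    [/\ 0 <= a <= len e, 0 <= b <= len e, linear_on e a b,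
        p = projective_map (epar e a) & q = projective_map (epar e b)] /\
    ((p = q /\ l = 0) \/ lattice_length p q l).

(* The path metric on the image in which the image of each segment on which
   all f_j are linear has its lattice length. *)
Definition image_dist : set ('I_n -> \bar R) -> set ('I_n -> \bar R) -> R :=
  chain_dist image_step.

End CanonicalMap.

Section Morphisms.
Context {R : realType}.

(* H is a model of the metric space A with distance d, via i. *)
Definition is_model T (A : set T) (d : T -> T -> R) (H : wgraph R)
    (i : gpoint H -> T) : Prop :=
  set_bij setT A i /\ forall x y, d (i x) (i y) = mdist x y.

Section Local.
Context {H H' : wgraph R}.
Variable psi : gpoint H -> gpoint H'.

Definition dilation (e : edge H) (m : nat) : Prop :=
  (m = 0%N /\ exists y, forall t, 0 <= t <= len e -> psi (epar e t) = y) \/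
  exists e' (b : bool) c, forall t, 0 <= t <= len e ->
    let t' := c + (-1) ^+ b * m%:R * t in
    0 <= t' <= len e' /\ psi (epar e t) = epar e' t'.

Definition edge_interior (K : wgraph R) (e : edge K) : set (gpoint K) :=
  [set epar e t | t in `]0, len e[%classic].

Definition morphism_of_models (deg : edge H -> nat) : Prop :=
  [/\ continuous psi,
      forall v, exists v', psi (inl v) = inl v',
      forall e', exists B : {set edge H},
        psi @^-1` edge_interior e' =
        \bigcup_(e in [set e | e \in B]) edge_interior e &
      forall e, dilation e (deg e)].

(* The half-edge h of x is mapped to the half-edge h' of psi x. *)
Definition half_edge_maps (x : gpoint H) (h : edge H * bool)
    (h' : edge H' * bool) : Prop :=
  exists2 c : R, 0 < c &
    \forall s \near 0^'+, psi (ray x h s) = ray (psi x) h' (c * s).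

Definition harmonic_at (deg : edge H -> nat) (x : gpoint H) : Prop :=
  exists k : nat, forall h', h' \in half_edges (psi x) ->
    (\sum_(h in half_edges x | `[< half_edge_maps x h h' >]) deg h.1)%N = k.

End Local.

(* phi is a map from the metric graph (A, d) to the metric graph (A', d'), and
   psi is phi read in the chosen models. *)
Definition is_harmonic T T' (A : set T) (d : T -> T -> R) (A' : set T')
    (d' : T' -> T' -> R) (phi : T -> T') : Prop :=
  exists (H H' : wgraph R) (i : gpoint H -> T) (i' : gpoint H' -> T')
    (psi : gpoint H -> gpoint H') (deg : edge H -> nat),
    [/\ is_model A d i, is_model A' d' i', forall x, i' (psi x) = phi (i x),
        morphism_of_models psi deg & forall x, harmonic_at psi deg x].

End Morphisms.

(* Main.v *)
(** Write R(K) for the real-valued functions of the canonical linear system and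
    x ~ y when every member of R(K) takes the same value at x and y; as constants
    belong to R(K), this is the relation phi x = phi y.

    At every point and in every direction some member of R(K) has slope 1 or -1:
    move one chip from each end of an arc towards its middle (when the arc is a
    loop at a trivalent vertex, bring a second chip to the vertex along the third
    edge).  Hence the slopes of the f_i along a segment have differences of gcd 1,
    the canonical map does not increase distances, and it is an isometry onto its
    image as soon as it is injective: the identity of the graph is then a harmonic
    model of it.

    Conversely, all degrees of a harmonic model are 1, so that the model is a
    covering of graphs away from the vertices, with fibres of constant
    cardinality.  If the map is not injective this cardinality is at least 2 and
    every germ of half-edge is identified with another one.  After smoothing the
    vertices of valence two, the function moving one chip from each end of an edge
    shows that a germ can only be identified with the germ at the other end of the
    same edge.  By harmonicity all edges at a vertex u then lead to the same vertex
    w, so the graph is a rose or a banana graph; having genus at least three, it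
    carries a member of R(K) with slopes -2 and -1 at the two ends of an edge, a
    contradiction. *)
Require Import Defs.
From mathcomp Require Import all_boot all_order all_algebra.
From mathcomp Require Import all_classical all_reals all_analysis.
From mathcomp Require Import lra zify.
Set Implicit Arguments.
Unset Strict Implicit.
Unset Printing Implicit Defensive.
Import Order.TTheory GRing.Theory Num.Theory.
Import numFieldNormedType.Exports.
Local Open Scope classical_set_scope.
Local Open Scope ring_scope.

(** * Oriented edges and germs *)

Section Darts.
Context {R : realType}.
Variable G : wgraph R.
Implicit Types (h k : edge G * bool) (x y : gpoint G) (s t : R).

Definition tail h : vertex G := if h.2 then tgt h.1 else src h.1.
Definition rev h : edge G * bool := (h.1, ~~ h.2).
Definition head h : vertex G := tail (rev h).

(* Half-edges double as oriented edges: dpar h parametrizes h from its tail. *)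
Definition dpar h t : gpoint G := epar h.1 (if h.2 then len h.1 - t else t).

(** Only meaningful when [h] is a half-edge of [x]. A vertex gets coordinate 0 because its
    half-edges start there, so vertices and interior points share the formula of [ray_dpar]. *)
Definition pos x h : R :=
  match x with
  | inl _ => 0
  | inr p => if h.2 then len h.1 - (sval p).2 else (sval p).2
  end.

Lemma revK : involutive rev.
Proof. by case=> e b; rewrite /rev negbK. Qed.

Lemma tail_rev h : tail (rev h) = head h.
Proof. by []. Qed.

Lemma head_rev h : head (rev h) = tail h.
Proof. by rewrite /head revK. Qed.

Lemma rev_neq h : rev h <> h.
Proof. by case: h => e [] []. Qed.

Lemma dart_rev_or h k : h.1 = k.1 -> k = h \/ k = rev h.
Proof. by case: h k => e [] [e' []] /= <-; [left|right|right|left]. Qed.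

Lemma dpar_rev h t : dpar (rev h) t = dpar h (len h.1 - t).
Proof. by case: h => e []; rewrite /dpar //= subKr. Qed.

Lemma dpar0 h : dpar h 0 = inl (tail h).
Proof. by case: h => e []; rewrite /dpar/= ?subr0 ?epar0 ?epar1. Qed.

Lemma dpar1 h : dpar h (len h.1) = inl (head h).
Proof. by case: h => e []; rewrite /dpar/= ?subrr ?epar0 ?epar1. Qed.

Lemma in_half_edges_vertex h v : (h \in half_edges (inl v : gpoint G)) = (tail h == v).
Proof. by rewrite inE. Qed.

Lemma in_half_edges_inner h p : (h \in half_edges (inr p : gpoint G)) = (h.1 == (sval p).1).
Proof. by rewrite inE. Qed.

Lemma ray_dpar x h s : ray x h s = dpar h (pos x h + s).
Proof.
rewrite /ray /dpar /pos; case: x => [v|p] //; case: h.2; congr epar;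
  by rewrite ?add0r//; lra.
Qed.

Lemma pos_ge0 x h : h \in half_edges x -> 0 <= pos x h.
Proof.
case: x => [v|p] //=; rewrite inE => /eqP hp; rewrite hp.
by have /andP[? ?] := svalP p; case: ifP => _; lra.
Qed.

Lemma pos_lt x h : h \in half_edges x -> pos x h < len h.1.
Proof.
case: x => [v|p] /=; first by rewrite len_gt0.
rewrite inE => /eqP hp; rewrite hp.
by have /andP[? ?] := svalP p; case: ifP => _; lra.
Qed.

Lemma dpar_pos x h : h \in half_edges x -> dpar h (pos x h) = x.
Proof.
case: x => [v|p] /=; first by rewrite inE dpar0 => /eqP <-.
rewrite inE => /eqP hp; rewrite /dpar /= hp -(epar_inner p); congr epar.
by case: h.2 => //; lra.
Qed.

Lemma dpar_inner h t : 0 < t < len h.1 ->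
  exists2 p, dpar h t = inr p & sval p = (h.1, if h.2 then len h.1 - t else t).
Proof.
move=> /andP[t0 tl]; rewrite /dpar /epar; case: insubP => [p _ pE|]; first by exists p.
by case: ifP => _ /=; rewrite negb_and -!leNgt => /orP[]; lra.
Qed.

Lemma half_edges_dpar h t : 0 <= t < len h.1 -> h \in half_edges (dpar h t).
Proof.
rewrite le_eqVlt => /andP[/orP[/eqP <- _|t0 tl]].
  by rewrite dpar0 in_half_edges_vertex.
have [|p -> pE] := @dpar_inner h t; first by rewrite t0.
by rewrite in_half_edges_inner pE.
Qed.

Lemma pos_dpar h t : 0 <= t < len h.1 -> pos (dpar h t) h = t.
Proof.
rewrite le_eqVlt => /andP[/orP[/eqP <- _|t0 tl]]; first by rewrite dpar0.
have [|p -> pE] := @dpar_inner h t; first by rewrite t0.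
by rewrite /pos pE /=; case: h.2 => //; lra.
Qed.

Lemma dpar_inj h k s t : 0 < s < len h.1 -> 0 <= t <= len k.1 ->
  dpar h s = dpar k t -> (k = h /\ t = s) \/ (k = rev h /\ t = len h.1 - s).
Proof.
move=> hs /andP[t0 tl]; have [p -> pE] := dpar_inner hs.
have [t0'|t0'] := eqVneq t 0; first by rewrite t0' dpar0.
have [tl'|tl'] := eqVneq t (len k.1); first by rewrite tl' dpar1.
have [|q -> qE] := @dpar_inner k t; first by rewrite !lt_neqAle eq_sym t0' t0 tl' tl.
case=> pq; move: qE; rewrite -pq pE => -[hk].
case: h k hk {hs pE t0 tl t0' tl' pq} => e [] [e' []] /= <- ?.
- by left; split => //; lra.
- by right; split => //; lra.
- by right; split => //; lra.
- by left; split => //; lra.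
Qed.

Lemma dpar_vertex h t v : 0 <= t <= len h.1 -> dpar h t = inl v ->
  t = 0 \/ t = len h.1.
Proof.
move=> /andP[t0 tl] hv; have [->|t0'] := eqVneq t 0; first by left.
have [->|tl'] := eqVneq t (len h.1); first by right.
have [|p pE _] := @dpar_inner h t; first by rewrite !lt_neqAle eq_sym t0' t0 tl' tl.
by rewrite pE in hv.
Qed.

Lemma gdist_dpar h s t : 0 <= s <= len h.1 -> 0 <= t <= len h.1 ->
  gdist (dpar h s) (dpar h t) <= `|s - t|.
Proof.
move=> hs ht; apply: gdist_le; rewrite -[X in schain _ _ _ X]addr0.
apply: chain_cons (chain_nil _ _); rewrite /dpar.
exists h.1, (if h.2 then len h.1 - s else s), (if h.2 then len h.1 - t else t).
by case: ifP => _; split=> //; try lra; rewrite distrC; congr `|_|; lra.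
Qed.

Lemma half_edges_inner_card p : #|half_edges (inr p : gpoint G)| = 2.
Proof.
rewrite (_ : half_edges _ = [set ((sval p).1, true); ((sval p).1, false)]%SET).
  by rewrite cards2 xpair_eqE eqxx.
by apply/setP => -[e []]; rewrite !inE /= !xpair_eqE ?andbT ?andbF ?orbF.
Qed.

Lemma gpoint_ind_dpar (P : gpoint G -> Prop) :
  (forall v, P (inl v)) ->
  (forall h t, 0 < t < len h.1 -> P (dpar h t)) -> forall x, P x.
Proof.
move=> Pv Pe [v|p]; first exact: Pv.
by rewrite -epar_inner; apply: (Pe ((sval p).1, false)); exact: (svalP p).
Qed.

End Darts.

Arguments revK {R G}.

Section OneSided.
Context {R : realType}.
Implicit Types (P : R -> Prop).

Lemma near0E P : (\forall s \near 0^'+, P s) <->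
  exists2 d : R, 0 < d & forall s, 0 < s -> s < d -> P s.
Proof.
split=> [|[d d0 dP]].
  rewrite near_withinE => /nbhs_ballP[d /= d0 dP]; exists d => // s s0 sd.
  by apply: dP => //=; rewrite /ball /= sub0r normrN gtr0_norm.
rewrite near_withinE; apply/nbhs_ballP; exists d => //= s.
by rewrite /ball /= sub0r normrN => sd s0; apply: dP => //; rewrite (le_lt_trans (ler_norm _)).
Qed.

(** Two affine functions agreeing at two points, here [e] and [e / 2], coincide. This makes the
    slope selected in [outgoing_slope] the actual one. *)
Lemma affine_germ_unique (a b : R) (m m' : int) (F : R -> R) :
  (\forall s \near 0^'+, F s = a + m%:~R * s) ->
  (\forall s \near 0^'+, F s = b + m'%:~R * s) -> a = b /\ m = m'.
Proof.
move=> /near0E[d d0 dP] /near0E[d' d0' dP'].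
pose e := Num.min d d' / 2.
have m0 : 0 < Num.min d d' by rewrite lt_min d0 d0'.
have e0 : 0 < e by rewrite /e; lra.
have ed : e < Num.min d d' by rewrite /e; lra.
have [e1 e2] : e < d /\ e < d' by move: ed; rewrite lt_min => /andP.
have := dP _ e0 e1; rewrite dP'// => E1.
have E2 : b + m'%:~R * (e / 2) = a + m%:~R * (e / 2).
  have [? ? ?] : [/\ 0 < e / 2, e / 2 < d & e / 2 < d'] by split; lra.
  by rewrite -dP// -dP'.
have mm : (m%:~R - m'%:~R) * (e / 2) = 0 :> R by lra.
move/eqP: mm; rewrite mulf_eq0 => /orP[|]; last by move/eqP => ?; exfalso; lra.
rewrite subr_eq0 eqr_int => /eqP mm; split=> //; move: E1; rewrite mm.
by move/eqP; rewrite (inj_eq (addIr _)) => /eqP.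
Qed.

End OneSided.

(** * Stars of points *)

Section Star.
Context {R : realType}.
Variable G : wgraph R.
Implicit Types (h k : edge G * bool) (x y : gpoint G) (s t : R).

(** Halving the least edge length keeps the stars at the two ends of an edge, in particular the two
    half-edges of a loop, from overlapping. *)
Definition star_radius x : R :=
  match x with
  | inl _ => (\big[Num.min/1]_(e : edge G) len e) / 2
  | inr p => Num.min (sval p).2 (len (sval p).1 - (sval p).2)
  end.

Lemma bigmin_len_gt0 : 0 < \big[Num.min/1]_(e : edge G) len e.
Proof.
elim/big_ind: _ => [//|a b a0 b0|e _]; last exact: len_gt0.
by rewrite lt_min a0 b0.
Qed.

Lemma bigmin_len_le (e : edge G) : \big[Num.min/1]_(e : edge G) len e <= len e.
Proof. by apply/bigmin_leP; right; exists e. Qed.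

Lemma star_radius_gt0 x : 0 < star_radius x.
Proof.
case: x => [v|p] /=; first by rewrite divr_gt0// bigmin_len_gt0.
by have /andP[? ?] := svalP p; rewrite lt_min; apply/andP; split; lra.
Qed.

Lemma star_radius_le x h : h \in half_edges x ->
  pos x h + star_radius x <= len h.1.
Proof.
case: x => [v|p] /=; first by have := bigmin_len_le h.1; have := len_gt0 h.1; rewrite add0r ler_pdivrMr//; lra.
rewrite inE => /eqP hp; rewrite hp.
have r1 : Num.min (sval p).2 (len (sval p).1 - (sval p).2) <= (sval p).2.
  by rewrite ge_min lexx.
have r2 : Num.min (sval p).2 (len (sval p).1 - (sval p).2) <=
    len (sval p).1 - (sval p).2 by rewrite ge_min lexx orbT.
by case: h.2; lra.
Qed.

Section TestFunction.
Variables (c : R) (u : edge G * bool -> R -> R).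
Hypothesis u_lip : forall h s t, 0 <= s -> 0 <= t -> u h s - u h t <= `|s - t|.
Hypothesis u0 : forall h, u h 0 = c.

Let u_dec h s t : 0 <= s -> s <= t -> u h s - u h t <= t - s.
Proof.
move=> s0 st; have := u_lip h s0 (le_trans s0 st).
by rewrite ler0_norm; lra.
Qed.

Let u_inc h s t : 0 <= t -> t <= s -> u h s - u h t <= s - t.
Proof.
move=> t0 ts; have := u_lip h (le_trans t0 ts) t0.
by rewrite ger0_norm; lra.
Qed.

(** On each edge the function switches at the midpoint from the profile at one end to the profile at
    the other. Both vanish there, the radius being at most half the edge, so a Lipschitz estimate
    across the midpoint splits into two. *)
Lemma star_function_vertex v : let x : gpoint G := inl v in
  (forall h s, star_radius x <= s -> u h s = 0) ->
  exists g : gpoint G -> R,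
    [/\ forall y z, g y - g z <= gdist y z, g x = c,
        forall h s, h \in half_edges x -> 0 <= s <= star_radius x ->
          g (dpar h (pos x h + s)) = u h s &
        forall y, g y != 0 -> y = x \/
          exists h s, [/\ h \in half_edges x, 0 <= s <= star_radius x &
                          y = dpar h (pos x h + s)]].
Proof.
move=> x uR.
pose F e t := if t <= len e / 2
  then (if src e == v then u (e, false) t else 0)
  else (if tgt e == v then u (e, true) (len e - t) else 0).
pose g (z : gpoint G) := match z with
  | inl w => if w == v then c else 0
  | inr q => F (sval q).1 (sval q).2 end.
have gE e t : 0 <= t <= len e -> g (epar e t) = F e t.
  move=> ht; have l0 := len_gt0 e; case: (eparP ht) => [->|->|q qE]; last by rewrite /g qE.
    by rewrite /g /F u0; case: leP => ? //; exfalso; lra.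
  by rewrite /g /F subrr u0; case: leP => ? //; exfalso; lra.
have rl (e : edge G) : star_radius x <= len e / 2.
  by rewrite ler_pM2r// bigmin_len_le.
have F0 e : u (e, false) (len e / 2) = 0 by rewrite uR.
have F1 e : u (e, true) (len e / 2) = 0 by rewrite uR.
exists g; split.
- move=> y z; apply: gdist_lip => e a b ha hb; rewrite !gE// /F.
  have l0 := len_gt0 e.
  have n1 := ler_norm (a - b); have n2 := ler_norm (b - a).
  rewrite (distrC b a) in n2.
  have n0 := normr_ge0 (a - b).
  have [sv|sv] := eqVneq (src e) v; have [tv|tv] := eqVneq (tgt e) v;
    case: (leP a (len e / 2)) => ca; case: (leP b (len e / 2)) => cb;
    rewrite ?subrr//.
  + by apply: u_lip; lra.
  + have := @u_dec (e, false) a (len e / 2); have := @u_inc (e, true) (len e / 2) (len e - b).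
    by rewrite F0 F1; lra.
  + have := @u_inc (e, false) (len e / 2) b; have := @u_dec (e, true) (len e - a) (len e / 2).
    by rewrite F0 F1; lra.
  + rewrite (_ : `|a - b| = `|(len e - a) - (len e - b)|); first by apply: u_lip; lra.
    by rewrite distrC; congr `|_|; lra.
  + by apply: u_lip; lra.
  + by have := @u_dec (e, false) a (len e / 2); rewrite F0; lra.
  + by have := @u_inc (e, false) (len e / 2) b; rewrite F0; lra.
  + by have := @u_inc (e, true) (len e / 2) (len e - b); rewrite F1; lra.
  + by have := @u_dec (e, true) (len e - a) (len e / 2); rewrite F1; lra.
  + rewrite (_ : `|a - b| = `|(len e - a) - (len e - b)|); first by apply: u_lip; lra.
    by rewrite distrC; congr `|_|; lra.
- by rewrite /g /= eqxx.
- move=> h s; rewrite inE => hv /andP[s0 sr]; have {sr} hr := le_trans sr (rl h.1).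
  have l0 := len_gt0 h.1.
  rewrite /pos add0r /dpar gE; last by case: h.2; lra.
  case: h hv hr l0 => e [] /= /eqP hv hr l0; rewrite /F ?hv ?eqxx.
    case: leP => ?; last by rewrite subKr.
    have sE : s = len e / 2 by lra.
    rewrite (_ : len e - s = len e / 2); last by lra.
    by rewrite F0 sE F1; case: ifP.
  by case: leP => // ?; exfalso; lra.
- case=> [w|q] /=; first by case: (w =P v) => [->|_]; [left|rewrite eqxx].
  rewrite /F; have /andP[q0 ql] := svalP q; rewrite -(epar_inner q).
  case: leP => ?; case: ifP => [/eqP ev|]; rewrite ?eqxx// => ne; right.
    exists ((sval q).1, false), (sval q).2; rewrite /pos add0r inE /= ev eqxx; split=> //.
    rewrite (ltW q0) leNgt; apply/negP => /ltW /uR => E.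
    by rewrite E eqxx in ne.
  exists ((sval q).1, true), (len (sval q).1 - (sval q).2).
  rewrite /pos add0r inE /dpar /= ev eqxx subKr; split=> //.
  rewrite subr_ge0 (ltW ql) leNgt; apply/negP => /ltW /uR => E.
  by rewrite E eqxx in ne.
Qed.

Lemma star_function_inner p : let x : gpoint G := inr p in
  (forall h s, star_radius x <= s -> u h s = 0) ->
  exists g : gpoint G -> R,
    [/\ forall y z, g y - g z <= gdist y z, g x = c,
        forall h s, h \in half_edges x -> 0 <= s <= star_radius x ->
          g (dpar h (pos x h + s)) = u h s &
        forall y, g y != 0 -> y = x \/
          exists h s, [/\ h \in half_edges x, 0 <= s <= star_radius x &
                          y = dpar h (pos x h + s)]].
Proof.
case: p => -[e0 t0] pt x uR; have /andP[/= t00 t0l] := pt.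
pose F e t := if e == e0 then
  (if t0 <= t then u (e0, false) (t - t0) else u (e0, true) (t0 - t)) else 0.
pose g (z : gpoint G) := if z is inr q then F (sval q).1 (sval q).2 else 0.
have r1 : star_radius x <= t0 by rewrite /= ge_min lexx.
have r2 : star_radius x <= len e0 - t0 by rewrite /= ge_min lexx orbT.
have gE e t : 0 <= t <= len e -> g (epar e t) = F e t.
  move=> ht; have l0 := len_gt0 e; case: (eparP ht) => [->|->|q qE]; last by rewrite /g qE.
    rewrite /g /F; case: eqP => // ee; case: leP => ?; first by exfalso; lra.
    by rewrite subr0 uR.
  rewrite /g /F; case: eqP => // ->; case: leP => ?; last by exfalso; lra.
  by rewrite uR.
exists g; split.
- move=> y z; apply: gdist_lip => e a b ha hb; rewrite !gE// /F.
  case: eqP => [ee|_]; last by rewrite subrr.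
  have n1 := ler_norm (a - b); have n2 := ler_norm (b - a).
  rewrite (distrC b a) in n2.
  case: (leP t0 a) => ca; case: (leP t0 b) => cb.
  + by rewrite (_ : a - b = (a - t0) - (b - t0)); [apply: u_lip|]; lra.
  + have := @u_inc (e0, false) (a - t0) 0; have := @u_dec (e0, true) 0 (t0 - b).
    by rewrite !u0; lra.
  + have := @u_inc (e0, true) (t0 - a) 0; have := @u_dec (e0, false) 0 (b - t0).
    by rewrite !u0; lra.
  + rewrite distrC (_ : b - a = (t0 - a) - (t0 - b)); [apply: u_lip|]; lra.
- by rewrite /g /= /F eqxx lexx subrr u0.
- move=> h s; rewrite inE => hv /andP[s0 sr].
  have s1 := le_trans sr r1; have s2 := le_trans sr r2.
  rewrite /dpar /pos gE; last by case: h hv => e [] /= /eqP ->; lra.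
  case: h hv => e [] /= /eqP ->; rewrite /F eqxx.
    case: leP => ?; last by congr (u _ _); lra.
    rewrite (_ : s = 0); last by lra.
    by rewrite (_ : _ - t0 = 0) ?u0//; lra.
  by case: leP => ?; [congr (u _ _); lra|exfalso; lra].
- case=> [w|q] /=; first by rewrite eqxx.
  rewrite /F; case: ((sval q).1 =P e0) => [qe|_]; rewrite ?eqxx//.
  rewrite -(epar_inner q) qe; case: leP => ? ne; right.
    exists (e0, false), ((sval q).2 - t0); rewrite inE /= eqxx /dpar /=.
    split=> //; last by congr epar; lra.
    rewrite subr_ge0; apply/andP; split=> //.
    rewrite leNgt; apply/negP => /ltW /uR => E.
    by rewrite E eqxx in ne.
  exists (e0, true), (t0 - (sval q).2); rewrite inE /= eqxx /dpar /=.
  split=> //; last by congr epar; lra.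
  apply/andP; split; first by lra.
  rewrite leNgt; apply/negP => /ltW /uR => E.
  by rewrite E eqxx in ne.
Qed.

(** A 1-Lipschitz function bounds [gdist] from below by its differences; lower bounds near [x] thus
    reduce to choosing a profile [u] on each half-edge. *)
Lemma star_function x :
  (forall h s, star_radius x <= s -> u h s = 0) ->
  exists g : gpoint G -> R,
    [/\ forall y z, g y - g z <= gdist y z, g x = c,
        forall h s, h \in half_edges x -> 0 <= s <= star_radius x ->
          g (dpar h (pos x h + s)) = u h s &
        forall y, g y != 0 -> y = x \/
          exists h s, [/\ h \in half_edges x, 0 <= s <= star_radius x &
                          y = dpar h (pos x h + s)]].
Proof. by case: x => [v|p]; [exact: star_function_vertex|exact: star_function_inner]. Qed.

End TestFunction.

Lemma gdist_base_ray x h s : h \in half_edges x -> 0 <= s <= star_radius x ->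
  gdist x (ray x h s) = s.
Proof.
move=> hx /andP[s0 sr]; have r0 := star_radius_gt0 x.
apply/eqP; rewrite eq_le; apply/andP; split.
  rewrite ray_dpar -{1}(dpar_pos hx).
  apply: le_trans (gdist_dpar _ _) _.
  - by rewrite pos_ge0// ltW// pos_lt.
  - by have := star_radius_le hx; have := pos_ge0 hx; lra.
  - by rewrite ler0_norm; lra.
(* The lower bound comes from a cone with apex at [x], which drops by exactly [s] along the ray. *)
have [||h' s' ?|g [gl gx gr _]] := @star_function (star_radius x)
    (fun _ t => Num.max 0 (star_radius x - t)) _ _ x.
- move=> _ a b a0 b0; apply: lipschitz_max; first by rewrite subrr.
  by have := ler_norm (b - a); rewrite distrC; lra.
- by move=> _; rewrite subr0 max_r// ltW.
- by rewrite max_l//; lra.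
have := gl x (ray x h s); rewrite gx ray_dpar gr//; last by rewrite s0.
by rewrite max_r; lra.
Qed.

(** The cone of height [star_radius x] is still positive at [y], and it is supported on the star. *)
Lemma gdist_star x y : gdist x y < star_radius x -> y = x \/
  exists2 h, h \in half_edges x & y = ray x h (gdist x y).
Proof.
move=> d; have r0 := star_radius_gt0 x.
have [||h' s' ?|g [gl gx gr gn]] := @star_function (star_radius x)
    (fun _ t => Num.max 0 (star_radius x - t)) _ _ x.
- move=> _ a b a0 b0; apply: lipschitz_max; first by rewrite subrr.
  by have := ler_norm (b - a); rewrite distrC; lra.
- by move=> _; rewrite subr0 max_r// ltW.
- by rewrite max_l//; lra.
have gy : g y != 0.
  by apply/eqP => gy; have := gl x y; rewrite gx gy; lra.
case: (gn y gy) => [|[h [s [hx sr yE]]]]; first by left.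
right; exists h => //; rewrite -ray_dpar in yE.
by rewrite {2}yE gdist_base_ray.
Qed.

(** A tent of slope one, taken positively on [h] and negatively on the other half-edges, separates
    the two points by [s + t]. The bound by half the radius keeps both points on the rising side of
    the tent. *)
Lemma gdist_rays x h k s t : h \in half_edges x -> k \in half_edges x -> h != k ->
  0 <= s <= star_radius x / 2 -> 0 <= t <= star_radius x / 2 ->
  s + t <= gdist (ray x h s) (ray x k t).
Proof.
move=> hx kx hk hs ht; have r0 := star_radius_gt0 x.
pose tent (t : R) := Num.max 0 (Num.min t (star_radius x - t)).
have tent_lip a b : tent a - tent b <= `|a - b|.
  have := ler_norm (a - b); have := ler_norm (b - a); rewrite (distrC b a) /tent => n1 n2.
  have n0 := normr_ge0 (a - b).
  apply: lipschitz_max; first by rewrite subrr.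
  by rewrite /Num.min; case: ltP => ?; case: ltP => ?; lra.
have tentE a : 0 <= a <= star_radius x / 2 -> tent a = a.
  by move=> ha; rewrite /tent min_l ?max_r//; lra.
pose w h' : R := if h' == h then 1 else -1.
have [|h'|h' s' ?|g [gl _ gr _]] := @star_function 0 (fun h' t => w h' * tent t) _ _ x.
- move=> h' a b a0 b0; rewrite /w; have := tent_lip a b; have := tent_lip b a.
  by rewrite (distrC b a); case: ifP => _; rewrite ?mul1r ?mulN1r; lra.
- by rewrite /tent min_l ?maxxx ?mulr0// subr0 ltW.
- rewrite /tent min_r; last by lra.
  by rewrite max_l ?mulr0//; lra.
have := gl (ray x h s) (ray x k t).
rewrite !ray_dpar !gr//; [|lra|lra].
by rewrite !tentE// /w eqxx eq_sym (negbTE hk) mul1r mulN1r opprK.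
Qed.

End Star.

(** * Isometries preserve germs *)

Section Germs.
Context {R : realType}.
Variable G : wgraph R.
Implicit Types (h k : edge G * bool) (x y : gpoint G) (s t : R) (g : gpoint G -> R).

Lemma gdist_ray_le x h s t : h \in half_edges x ->
  0 <= s <= star_radius x -> 0 <= t <= star_radius x ->
  gdist (ray x h s) (ray x h t) <= `|s - t|.
Proof.
move=> hx hs ht; rewrite !ray_dpar.
have := star_radius_le hx; have := pos_ge0 hx => p0 pl.
apply: le_trans (gdist_dpar _ _) _; try lra.
by rewrite (_ : _ - _ = s - t)//; lra.
Qed.

Lemma ray_inj x h k s : h \in half_edges x -> k \in half_edges x ->
  0 < s <= star_radius x / 2 -> ray x h s = ray x k s -> h = k.
Proof.
move=> hx kx hs E; apply/eqP; apply/negP => /negP hk.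
have := @gdist_rays _ _ x h k s s hx kx hk; rewrite E gdistxx; lra.
Qed.

Definition germ_affine g x h (m : int) : Prop :=
  \forall s \near 0^'+, g (ray x h s) = g x + m%:~R * s.

Lemma outgoing_slopeE g x h m : germ_affine g x h m -> outgoing_slope g x h = m.
Proof.
move=> hm; have [_ ->//] : g x = g x /\ outgoing_slope g x h = m.
apply: (affine_germ_unique _ hm); rewrite /outgoing_slope.
exact: (@xgetI _ 0 [set m : int | germ_affine g x h m] m hm).
Qed.

(** Membership in R(K) in a local form that mentions germs only: it is invariant under isometries,
    hence independent of the model, and [linear_systemP] recovers the finite partitions by
    compactness. *)
Definition canonical_function g : Prop :=
  (forall x h, h \in half_edges x -> exists m, germ_affine g x h m) /\
  forall x, 0 <= canonical_divisor G x + ord_at g x.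

End Germs.

Section Isometry.
Context {R : realType} {G G' : wgraph R}.
Variable theta : gpoint G -> gpoint G'.
Hypothesis theta_dist : forall x y, gdist (theta x) (theta y) = gdist x y.

Lemma isometry_inj : injective theta.
Proof. by move=> x y xy; apply: gdist_positivity; rewrite -theta_dist xy gdistxx. Qed.

(** The image of the point at distance [s] lies at distance [s] from [theta x], so on some ray; it
    remains to see that this ray does not depend on [s]. *)
Lemma isometry_germ x h : h \in half_edges x ->
  exists2 k, k \in half_edges (theta x) &
    \forall s \near 0^'+, theta (ray x h s) = ray (theta x) k s.
Proof.
move=> hx; have r0 := star_radius_gt0 x; have r0' := star_radius_gt0 (theta x).
pose r := Num.min (star_radius x) (star_radius (theta x)) / 2.
have rm0 : 0 < Num.min (star_radius x) (star_radius (theta x)) by rewrite lt_min r0.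
have rm1 : Num.min (star_radius x) (star_radius (theta x)) <= star_radius x.
  by rewrite ge_min lexx.
have rm2 : Num.min (star_radius x) (star_radius (theta x)) <= star_radius (theta x).
  by rewrite ge_min lexx orbT.
have [rp r1 r2] : [/\ 0 < r, r <= star_radius x & r <= star_radius (theta x) / 2].
  by rewrite /r; split; lra.
have key (s : R) : 0 < s <= r -> exists2 k, k \in half_edges (theta x) &
    theta (ray x h s) = ray (theta x) k s.
  move=> hs; have ds : gdist (theta x) (theta (ray x h s)) = s.
    by rewrite theta_dist gdist_base_ray//; lra.
  have [|E|[k kx E]] := @gdist_star _ _ (theta x) (theta (ray x h s)).
  - by rewrite ds; lra.
  - by move: ds; rewrite E gdistxx; lra.
  - by exists k => //; rewrite E ds.
have [|k kx kE] := key r; first by rewrite rp lexx.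
exists k => //; apply/near0E; exists r => // s s0 sr.
have [|k' kx' kE'] := key s; first by lra.
have [<-//|kk'] := eqVneq k' k; exfalso.
(* On different rays the images would be at least [s + r] apart, but their distance is at most
   [r - s]. *)
have := gdist_rays kx' kx kk' (s := s) (t := r).
rewrite -kE -kE' theta_dist.
have := @gdist_ray_le _ _ x h s r hx.
by rewrite ltr0_norm; lra.
Qed.

Hypothesis theta_surj : forall y, exists x, theta x = y.

Lemma isometry_inverse : exists theta' : gpoint G' -> gpoint G,
  [/\ cancel theta theta', cancel theta' theta &
      forall x y, gdist (theta' x) (theta' y) = gdist x y].
Proof.
have [theta' thetaK] := choice theta_surj; exists theta'; split=> //.
- by move=> x; apply: isometry_inj; rewrite thetaK.
- by move=> x y; rewrite -theta_dist !thetaK.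
Qed.

End Isometry.

Section IsometryGerms.
Context {R : realType} {G G' : wgraph R}.
Variable theta : gpoint G -> gpoint G'.
Hypothesis theta_dist : forall x y, gdist (theta x) (theta y) = gdist x y.
Hypothesis theta_surj : forall y, exists x, theta x = y.

Lemma isometry_half_edges x : exists sigma : edge G * bool -> edge G' * bool,
  [/\ forall h, h \in half_edges x ->
        \forall s \near 0^'+, theta (ray x h s) = ray (theta x) (sigma h) s,
      {in half_edges x &, injective sigma} &
      half_edges (theta x) = (sigma @: half_edges x)%SET].
Proof.
have key h : exists k, h \in half_edges x -> k \in half_edges (theta x) /\
    \forall s \near 0^'+, theta (ray x h s) = ray (theta x) k s.
  have [hx|_] := boolP (h \in half_edges x).
    by have [k kx kE] := isometry_germ theta_dist hx; exists k.
  (* [choice] wants a value also when [h] does not start at [x]; the image of the germ of [h] at its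
     own tail shows that [G'] has a half-edge at all. *)
  have [|k _ _] := isometry_germ theta_dist (half_edges_dpar (h := h) (t := 0) _).
    by rewrite lexx len_gt0.
  by exists k.
have [sigma sP] := choice key.
have inj_sigma : {in half_edges x &, injective sigma}.
  move=> h h' hx hx' E; have [_ /near0E[d d0 dP]] := sP _ hx.
  have [_ /near0E[d' d0' dP']] := sP _ hx'.
  have r0 := star_radius_gt0 x.
  pose s := Num.min (Num.min d d') (star_radius x) / 2.
  have m0 : 0 < Num.min (Num.min d d') (star_radius x) by rewrite !lt_min d0 d0'.
  have m1 : Num.min (Num.min d d') (star_radius x) <= d by rewrite !ge_min lexx.
  have m2 : Num.min (Num.min d d') (star_radius x) <= d'.
    by rewrite !ge_min lexx orbT.
  have m3 : Num.min (Num.min d d') (star_radius x) <= star_radius x.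
    by rewrite !ge_min lexx !orbT.
  have hs : [/\ 0 < s, s < d, s < d' & s <= star_radius x / 2].
    by rewrite /s; split; lra.
  case: hs => s0 s1 s2 s3.
  apply: (@ray_inj _ _ x h h' s) => //; first by rewrite s0.
  by apply: (isometry_inj theta_dist); rewrite dP// dP'// E.
exists sigma; split=> [h /sP[]//|//|].
apply/setP => k; apply/idP/imsetP => [kx|[h /sP[hx _] ->//]].
have [theta' [thetaK thetaK' td']] := isometry_inverse theta_dist theta_surj.
have [h] := isometry_germ td' kx; rewrite thetaK => hx /near0E[d d0 dP].
exists h => //; have [kx' /near0E[d' d0' dP']] := sP _ hx.
have r0 := star_radius_gt0 (theta x).
pose m := Num.min (Num.min d d') (star_radius (theta x)).
have m0 : 0 < m by rewrite !lt_min d0 d0'.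
have m1 : m <= d by rewrite !ge_min lexx.
have m2 : m <= d' by rewrite !ge_min lexx orbT.
have m3 : m <= star_radius (theta x) by rewrite !ge_min lexx !orbT.
apply: (@ray_inj _ _ (theta x) k (sigma h) (m / 2)) => //; first by lra.
by rewrite -dP'; [rewrite -dP ?thetaK'//; lra|lra|lra].
Qed.

Lemma isometry_valence x : valence (theta x) = valence x.
Proof.
have [sigma [_ inj_s E]] := isometry_half_edges x.
by rewrite /valence E card_in_imset.
Qed.

Lemma isometry_germ_affine x h k m (g : gpoint G' -> R) :
  (\forall s \near 0^'+, theta (ray x h s) = ray (theta x) k s) ->
  germ_affine g (theta x) k m -> germ_affine (g \o theta) x h m.
Proof.
move=> hE gE; rewrite /germ_affine; near=> s.
by rewrite /comp (near hE s)// (near gE s).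
Unshelve. all: by end_near. Qed.

(** Valence and outgoing slopes are read off germs, which [theta] carries bijectively. Test
    functions may therefore be built on whichever model is convenient. *)
Lemma isometry_canonical_function g : canonical_function g ->
  canonical_function (g \o theta).
Proof.
move=> [g1 g2]; split.
  move=> x h hx; have [k kx kE] := isometry_germ theta_dist hx.
  by have [m mE] := g1 _ _ kx; exists m; apply: isometry_germ_affine kE mE.
move=> x; have := g2 (theta x); rewrite /ord_at /canonical_divisor /= isometry_valence.
have [sigma [sE inj_s E]] := isometry_half_edges x.
rewrite E big_imset//= => ge0; congr (_ <= _ + _): ge0; apply: eq_bigr => h hx.
have [|m mE] := g1 (theta x) (sigma h); first by rewrite E imset_f.
by rewrite (outgoing_slopeE mE) (outgoing_slopeE (isometry_germ_affine (sE _ hx) mE)).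
Qed.

End IsometryGerms.

(** * Piecewise linearity is local *)

Section Creeping.
Context {R : realType}.
Implicit Types (a b t x y z : R).

(* Induction on a compact interval: the supremum of the t with P a t is b. *)
Lemma interval_induction (P : R -> R -> Prop) a b : a <= b ->
  (forall t, P t t) -> (forall x y z, P x y -> P y z -> P x z) ->
  (forall t, a <= t < b -> exists2 d : R, 0 < d &
     forall t', t < t' < t + d -> t' <= b -> P t t') ->
  (forall t, a < t <= b -> exists2 d : R, 0 < d &
     forall t', t - d < t' < t -> a <= t' -> P t' t) ->
  P a b.
Proof.
move=> ab Prefl Ptrans Pright Pleft.
pose S := [set t : R | a <= t <= b /\ P a t].
have Sa : S a by split=> //; rewrite lexx.
have hsS : has_sup S by split; [exists a|exists b => t [/andP[]]].
have ac : a <= sup S by apply: ub_le_sup => //; case: hsS.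
have cb : sup S <= b by apply: ge_sup; [exists a|move=> t [/andP[]]].
have Pc : P a (sup S).
  have [<-//|nac] := eqVneq a (sup S).
  have [|d d0 dP] := Pleft (sup S); first by rewrite lt_neqAle nac ac.
  have [t [/andP[a_t tb] Pat] ct] := sup_adherent d0 hsS.
  have := @ub_le_sup _ S hsS.2 t (conj (introT andP (conj a_t tb)) Pat).
  rewrite le_eqVlt => /orP[/eqP <-//|tc].
  by apply: Ptrans Pat (dP _ _ a_t); rewrite ct tc.
have [<-//|ncb] := eqVneq (sup S) b.
have cb' : sup S < b by rewrite lt_neqAle ncb cb.
have [|d d0 dP] := Pright (sup S); first by rewrite ac.
pose t := Num.min (sup S + d / 2) b.
have ct : sup S < t by rewrite lt_min cb' andbT; lra.
have td : t <= sup S + d / 2 by rewrite ge_min lexx.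
have tb : t <= b by rewrite ge_min lexx orbT.
have St : S t.
  split; first by lra.
  by apply: Ptrans Pc (dP _ _ _) => //; lra.
by have := @ub_le_sup _ S hsS.2 t St; rewrite leNgt ct.
Qed.

Lemma itv_partition_pieceR a b s t : itv_partition a b s -> a <= t < b ->
  exists2 k, (k < size s)%N & nth 0 (a :: s) k <= t < nth 0 s k.
Proof.
elim: s a => [|c s IH] a ps hab; first by move: hab; rewrite (itv_partition_nil ps); lra.
have [tc|ct] := ltP t c; first by exists 0%N => //=; rewrite tc andbT; case/andP: hab.
have [|k ks kt] := IH c (itv_partition_cons ps) _; first by case/andP: hab => _ ->; rewrite ct.
by exists k.+1.
Qed.

Lemma itv_partition_pieceL a b s t : itv_partition a b s -> a < t <= b ->
  exists2 k, (k < size s)%N & nth 0 (a :: s) k < t <= nth 0 s k.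
Proof.
elim: s a => [|c s IH] a ps hab; first by move: hab; rewrite (itv_partition_nil ps); lra.
have [ct|tc] := ltP c t; last by exists 0%N => //=; rewrite tc andbT; case/andP: hab.
have [|k ks kt] := IH c (itv_partition_cons ps) _; first by case/andP: hab => _ ->; rewrite ct.
by exists k.+1.
Qed.

End Creeping.

Section PiecewiseLinear.
Context {R : realType}.
Variable G : wgraph R.
Implicit Types (h : edge G * bool) (x : gpoint G) (t : R) (g : gpoint G -> R).

Lemma pw_linear_germ g x h : pw_linear g -> h \in half_edges x ->
  exists m, germ_affine g x h m.
Proof.
move=> gl hx; have p0 := pos_ge0 hx; have pl := pos_lt hx.
have [s sp sE] := gl h.1.
have xE : g x = g (dpar h (pos x h)) by rewrite dpar_pos.
case: h hx p0 pl s sp sE xE => e [] hx p0 pl s sp sE xE.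
  (* Against the orientation the germ stays in the piece to the left of the point, and its slope
     changes sign. *)
  have [|k ks /andP[k1 k2]] := itv_partition_pieceL (t := len e - pos x (e, true)) sp.
    by move: p0 pl => /=; lra.
  have [m mE] := sE k ks; exists (- m).
  apply/near0E; exists (len e - pos x (e, true) - nth 0 (0 :: s) k).
    by rewrite subr_gt0.
  move=> d d0 dk; rewrite ray_dpar xE /dpar /= mE; last by lra.
  by rewrite [in RHS]mE ?mulrNz; lra.
have [|k ks /andP[k1 k2]] := itv_partition_pieceR (t := pos x (e, false)) sp.
  by move: p0 pl => /=; lra.
have [m mE] := sE k ks; exists m.
apply/near0E; exists (nth 0 s k - pos x (e, false)).
  by rewrite subr_gt0.
move=> d d0 dk; rewrite ray_dpar xE /dpar /= mE; last by lra.
by rewrite [in RHS]mE; lra.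
Qed.

(** Each point of an edge has one-sided neighbourhoods on which [g] is affine; compactness, as
    [interval_induction], leaves finitely many pieces. *)
Lemma germ_pw_linear g :
  (forall x h, h \in half_edges x -> exists m, germ_affine g x h m) -> pw_linear g.
Proof.
move=> gl e; have l0 := len_gt0 e.
pose P (a b : R) := exists2 s : seq R, itv_partition a b s &
    forall k : nat, (k < size s)%N -> exists m : int,
      forall t, nth 0 (a :: s) k <= t <= nth 0 s k ->
        g (epar e t) =
        g (epar e (nth 0 (a :: s) k)) + m%:~R * (t - nth 0 (a :: s) k).
suff : P 0 (len e) by [].
apply: interval_induction.
- exact: ltW.
- by move=> t; exists [::] => //; split=> //=.
- move=> a b c [s sp sE] [s' sp' sE']; exists (s ++ s').
    exact: itv_partition_cat sp sp'.
  move=> k; rewrite size_cat => kss.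
  have lb : last a s = b by case: sp => _ /eqP.
  have [ks|ks] := ltnP k (size s).
    have [m mE] := sE k ks; exists m.
    by rewrite -cat_cons !nth_cat /= ks (ltn_trans ks).
  have [|m mE] := sE' (k - size s)%N; first by lia.
  exists m; rewrite -cat_cons !nth_cat /= (ltnNge k (size s)) ks /=.
  have [ks'|ks'] := ltnP k (size s).+1.
    have kE : k = size s by lia.
    move: mE; rewrite kE subnn /= => mE.
    have -> : nth 0 (a :: s) (size s) = b by rewrite nth_last -lb.
    exact: mE.
  move: mE; rewrite (_ : (k - size s)%N = (k - (size s).+1).+1); last by lia.
  by [].
- move=> t ht; have ht' : 0 <= t < len (e, false).1 by [].
  have [m /near0E[d d0 dP]] := gl _ _ (half_edges_dpar ht').
  exists d => // t' /andP[tt' t'd] t'l; exists [:: t'].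
    exact: itv_partition1.
  case=> // _; exists m => t'' /= /andP[]; rewrite le_eqVlt => /orP[/eqP <- _|tt'' t''t'].
    by rewrite subrr mulr0 addr0.
  have := dP (t'' - t); rewrite ray_dpar pos_dpar// /dpar /= => <-; try lra.
  by congr (g (epar e _)); lra.
- move=> t ht; have ht' : 0 <= len e - t < len (e, true).1 by rewrite /=; lra.
  have [m /near0E[d d0 dP]] := gl _ _ (half_edges_dpar ht').
  exists d => // t' /andP[t'd t't] t'0; exists [:: t].
    exact: itv_partition1.
  case=> // _; exists (- m) => t'' /= /andP[t't'']; rewrite le_eqVlt.
  (* The germ is based at the right end [t] of the piece, whereas [pw_linear] measures from the left
     end [t']. *)
  have tE : g (epar e t') = g (epar e t) + m%:~R * (t - t').
    have := dP (t - t'); rewrite ray_dpar pos_dpar// /dpar /= subKr => <-; try lra.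
    by congr (g (epar e _)); lra.
  rewrite tE => /orP[/eqP ->|t''t].
    by rewrite mulrNz; lra.
  have := dP (t - t''); rewrite ray_dpar pos_dpar// /dpar /= subKr => E.
  rewrite (_ : t'' = len e - (len e - t + (t - t''))); last by lra.
  by rewrite E; lra.
Qed.

Lemma linear_systemP g :
  linear_system (canonical_divisor G) (EFin \o g) <-> canonical_function g.
Proof.
split=> [[E|[g' [gl g0] E]]|[gl g0]].
- have [v _] := card_gt0P (wgraph_nonempty G).
  by have := congr1 (@^~ (inl v)) E.
- have <- : g' = g by apply/funext => x; have := congr1 (@^~ x) E; case.
  by split=> // x h; exact: pw_linear_germ.
- by right; exists g => //; split=> //; exact: germ_pw_linear.
Qed.

End PiecewiseLinear.

(** * Functions with prescribed slopes at the ends of edges *)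

Lemma canonical_divisorE (R : realType) (G : wgraph R) (x : gpoint G) :
  canonical_divisor G x = (valence x)%:Z - 2.
Proof. by []. Qed.

Section TwoSlope.
Context {R : realType}.
Variable G : wgraph R.
Variables (pv : vertex G -> R) (a : edge G * bool -> int).
Implicit Types (h : edge G * bool) (x : gpoint G) (s t : R).

(* Convex on h, with values pv at the ends; its outgoing slope at the tail of h
   is - a h unless the other affine function dominates everywhere. *)
Definition two_slope_on h t : R :=
  Num.max (pv (tail h) - (a h)%:~R * t)
          (pv (head h) - (a (rev h))%:~R * (len h.1 - t)).

Definition two_slope x : R :=
  match x with
  | inl v => pv v
  | inr q => two_slope_on ((sval q).1, false) (sval q).2
  end.

Hypothesis a_convex : forall h, 0 <= a h + a (rev h).
Hypothesis a_ends : forall h,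
  pv (head h) - (a (rev h))%:~R * len h.1 <= pv (tail h).

Lemma two_slope_on_rev h t : two_slope_on (rev h) t = two_slope_on h (len h.1 - t).
Proof. by rewrite /two_slope_on tail_rev head_rev revK /= subKr maxC. Qed.

Lemma two_slopeE h t : 0 <= t <= len h.1 ->
  two_slope (dpar h t) = two_slope_on h t.
Proof.
wlog : h t / h.2 = false => [wl ht|h2 ht].
  have [h2|h2] := boolP h.2; last by apply: wl => //; apply/negbTE.
  rewrite -[h in LHS]revK dpar_rev wl; [|by rewrite /= h2|by rewrite /=; lra].
  by rewrite two_slope_on_rev /= subKr.
have l0 := len_gt0 h.1.
have [->|t0] := eqVneq t 0.
  rewrite dpar0 /two_slope_on mulr0 !subr0 max_l//; exact: a_ends.
have [->|tl] := eqVneq t (len h.1).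
  rewrite dpar1 /two_slope_on subrr mulr0 !subr0 max_r//.
  by have := a_ends (rev h); rewrite head_rev tail_rev revK.
have [|q -> qE] := @dpar_inner _ _ h t.
  by rewrite !lt_neqAle eq_sym t0 tl.
by rewrite /= qE h2 /=; case: h h2 {ht l0 tl qE} => e b /= ->.
Qed.

(** A tie goes to the second case: moving along [h], the affine function of larger slope [a (rev h)]
    takes over. *)
Definition two_slope_germ h t : int :=
  if pv (head h) - (a (rev h))%:~R * (len h.1 - t) < pv (tail h) - (a h)%:~R * t
  then - a h else a (rev h).

Lemma two_slope_germP x h : h \in half_edges x ->
  germ_affine two_slope x h (two_slope_germ h (pos x h)).
Proof.
move=> hx; have p0 := pos_ge0 hx; have pl := pos_lt hx.
have c0 : 0 <= (a h)%:~R + (a (rev h))%:~R :> R.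
  by rewrite -intrD ler0z.
set p := pos x h in p0 pl *.
have xE : two_slope x = two_slope_on h p.
  by rewrite -two_slopeE ?dpar_pos//; lra.
apply/near0E; rewrite xE /two_slope_germ.
set A := (a h)%:~R in c0 *; set B := (a (rev h))%:~R in c0 *.
case: ltP => [gt|le]; last first.
  exists (len h.1 - p); first by lra.
  move=> s s0 sl; rewrite ray_dpar -/p two_slopeE; last by lra.
  rewrite /two_slope_on -/A -/B max_r ?max_r//; first by lra.
  have : 0 <= (A + B) * s by rewrite mulr_ge0// ltW.
  by lra.
pose D := pv (tail h) - A * p - (pv (head h) - B * (len h.1 - p)).
have D0 : 0 < D by rewrite /D; lra.
(* The gap [D] between the two affine functions closes at rate [A + B]; the added 1 keeps the
   denominator positive. *)
exists (Num.min (len h.1 - p) (D / (A + B + 1))).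
  by rewrite lt_min divr_gt0 ?andbT//; lra.
move=> s s0; rewrite lt_min => /andP[sl]; rewrite ltr_pdivlMr; last by lra.
move=> sD; rewrite ray_dpar -/p two_slopeE; last by lra.
rewrite /two_slope_on -/A -/B max_l ?max_l//; last 2 first.
- exact: ltW.
- by move: sD; rewrite /D; lra.
by rewrite mulrNz -/A; lra.
Qed.

Hypothesis a_canonical : forall v,
  \sum_(h in half_edges (inl v : gpoint G)) a h <= (valence (inl v : gpoint G))%:Z - 2.

Lemma two_slope_germ_ge h t : - a h <= two_slope_germ h t.
Proof.
by rewrite /two_slope_germ; case: ifP => // _; have := a_convex h; lia.
Qed.

(** At a vertex the outgoing slopes are at least [- a h], so at most the available [valence - 2]
    chips leave; inside an edge convexity makes the order nonnegative. *)
Lemma two_slope_canonical : canonical_function two_slope.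
Proof.
split=> [x h hx|x]; first by eexists; exact: two_slope_germP.
have -> : ord_at two_slope x =
    \sum_(h in half_edges x) two_slope_germ h (pos x h).
  by apply: eq_bigr => h hx; exact: outgoing_slopeE (two_slope_germP hx).
case: x => [v|q].
  have := a_canonical v; rewrite canonical_divisorE.
  have : \sum_(h in half_edges (inl v : gpoint G)) - a h <=
      \sum_(h in half_edges (inl v : gpoint G)) two_slope_germ h 0.
    by apply: ler_sum => h _; exact: two_slope_germ_ge.
  by rewrite sumrN /pos; lra.
rewrite canonical_divisorE /valence half_edges_inner_card subrr add0r.
have -> : half_edges (inr q : gpoint G) =
    [set ((sval q).1, true); ((sval q).1, false)]%SET.
  by apply/setP => -[e []]; rewrite !inE /= !xpair_eqE ?andbT ?andbF ?orbF.
rewrite big_setU1 ?inE ?xpair_eqE ?andbF//= big_set1.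
rewrite /two_slope_germ /rev /head /tail /= subKr.
have := a_convex ((sval q).1, true); rewrite /rev /=.
set A := a (_, true); set B := a (_, false) => AB.
case: ltP => lt1; case: ltP => lt2; try lia.
(* The remaining case has each affine function strictly above the other. *)
by have := lt_trans lt1 lt2; rewrite ltxx.
Qed.

End TwoSlope.

(** * Test functions on graphs of valence at least three *)

Lemma near0_pick (R : realType) (P : R -> Prop) (e : R) : 0 < e ->
  (\forall s \near 0^'+, P s) -> exists s : R, [/\ 0 < s, s < e & P s].
Proof.
move=> e0 /near0E[d d0 dP]; pose m := Num.min d e.
have m0 : 0 < m by rewrite lt_min d0 e0.
have m1 : m <= d by rewrite ge_min lexx.
have m2 : m <= e by rewrite ge_min lexx orbT.
by exists (m / 2); split; [lra|lra|apply: dP; lra].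
Qed.

Section TestFunctions.
Context {R : realType}.
Variable G : wgraph R.
Hypothesis val3 : forall v, (3 <= valence (inl v : gpoint G))%N.
Implicit Types (h k : edge G * bool) (x : gpoint G) (v : vertex G) (e : edge G).

Lemma sum_half_edges_support v h0 (F : edge G * bool -> int) :
  (forall h, h <> h0 -> h <> rev h0 -> F h = 0) ->
  \sum_(h in half_edges (inl v : gpoint G)) F h =
  (if tail h0 == v then F h0 else 0) + (if head h0 == v then F (rev h0) else 0).
Proof.
move=> F0; rewrite (eq_bigl (fun h => tail h == v)); last first.
  by move=> h; rewrite in_half_edges_vertex.
rewrite big_mkcond /= (bigD1 h0)//= (bigD1 (rev h0))/=; last exact/eqP/rev_neq.
rewrite big1 ?addr0// => h /andP[/eqP h1 /eqP h2].
by case: ifP => // _; exact: F0.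
Qed.

(** With zero potential and [p], [q] positive, [p] chips leave the tail of [h0] and [q] chips its
    head towards one another: the function is negative inside that edge and zero elsewhere. *)
Definition peak h0 (p q : nat) h : int :=
  if h == h0 then p%:Z else if h == rev h0 then q%:Z else 0.

Lemma peakl h0 p q : peak h0 p q h0 = p%:Z.
Proof. by rewrite /peak eqxx. Qed.

Lemma peakr h0 p q : peak h0 p q (rev h0) = q%:Z.
Proof. by rewrite /peak eqxx; case: eqP => // /rev_neq. Qed.

Lemma peak_canonical h0 (p q : nat) :
  (forall v, (tail h0 == v) * p + (head h0 == v) * q + 2 <= valence (inl v : gpoint G))%N ->
  canonical_function (two_slope (fun _ : vertex G => 0 : R) (peak h0 p q)).
Proof.
move=> hv; have p0 h : 0 <= peak h0 p q h.
  by rewrite /peak; case: ifP => // _; case: ifP.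
apply: two_slope_canonical.
- by move=> h; rewrite addr_ge0.
- move=> h; rewrite sub0r oppr_le0 mulr_ge0// ?ler0z//; exact/ltW/len_gt0.
- move=> v; rewrite (@sum_half_edges_support v h0).
    by have := hv v; rewrite peakl peakr; case: eqP => _; case: eqP => _; lia.
  by move=> h /eqP/negbTE h1 /eqP/negbTE h2; rewrite /peak h1 h2.
Qed.

Lemma peakE h0 p q h t : 0 <= t <= len h.1 ->
  two_slope (fun _ : vertex G => 0 : R) (peak h0 p q) (dpar h t) =
  Num.max (- ((peak h0 p q h)%:~R * t))
          (- ((peak h0 p q (rev h))%:~R * (len h.1 - t))).
Proof.
move=> ht; rewrite two_slopeE// ?/two_slope_on ?sub0r//.
move=> h'; rewrite sub0r oppr_le0 mulr_ge0// ?ler0z//; last exact/ltW/len_gt0.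
by rewrite /peak; case: ifP => // _; case: ifP.
Qed.

(** A trivalent vertex carries a single chip of K, whereas a loop takes two chips from its base. *)
Lemma peak11_canonical h0 :
  (tail h0 = head h0 -> 4 <= valence (inl (tail h0) : gpoint G))%N ->
  canonical_function (two_slope (fun _ : vertex G => 0 : R) (peak h0 1 1)).
Proof.
move=> loop; apply: peak_canonical => v; have := val3 v.
by case: eqP => [<-|_]; case: eqP => [E|_]; try lia; have := loop (esym E); lia.
Qed.

(* The edge e is a loop at a trivalent vertex and k is the third half-edge there:
   one chip moves along k to the vertex and, when c = 1, two chips move from
   there along e. *)
Section Lollipop.
Variables (e : edge G) (k : edge G * bool) (c : nat).
Hypotheses (src_e : src e = tail k) (tgt_e : tgt e = tail k) (ke : k.1 != e).
Hypothesis val_k : valence (inl (tail k) : gpoint G) = 3%N.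
Hypothesis c1 : (c <= 1)%N.

Lemma lollipop_half_edges : half_edges (inl (tail k) : gpoint G) =
  [set k; (e, false); (e, true)]%SET.
Proof.
apply/esym/eqP; rewrite eqEcard; apply/andP; split.
  apply/fintype.subsetP => h; rewrite !inE.
  by case/orP => [/orP[]|] /eqP -> /=; rewrite ?src_e ?tgt_e ?eqxx.
rewrite -/(valence _) val_k -finset.setUA !cardsU1 !inE cards1 xpair_eqE andbF.
by case: k ke => e' b /= /negbTE ke'; rewrite !xpair_eqE ke'.
Qed.

(** The value [- len k.1] makes the function affine of slope one along [k], from its tail up to zero
    at its head. *)
Definition lollipop_pot v : R := if v == tail k then - len k.1 else 0.

Definition lollipop_slope h : int :=
  if h == k then -1 else if h == rev k then 1 else if h.1 == e then c%:Z else 0.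

Lemma head_lollipop : head k != tail k.
Proof.
apply/eqP => hk; have : rev k \in half_edges (inl (tail k) : gpoint G).
  by rewrite in_half_edges_vertex tail_rev hk.
rewrite lollipop_half_edges !inE; case/orP => [/orP[/eqP/rev_neq//|]|] /eqP E;
  by move/eqP: ke; apply; rewrite -[k.1]/(rev k).1 E.
Qed.

Lemma lollipop_convex h : 0 <= lollipop_slope h + lollipop_slope (rev h).
Proof.
rewrite /lollipop_slope /= (can2_eq revK revK) (inj_eq (can_inj revK)).
case: (eqVneq h k) => [->|hk]; first by case: eqP => // /esym /rev_neq.
by case: eqP => // _; case: eqP.
Qed.

Lemma lollipop_ends h :
  lollipop_pot (head h) - (lollipop_slope (rev h))%:~R * len h.1 <= lollipop_pot (tail h).
Proof.
have l0 := len_gt0 h.1; have k0 := len_gt0 k.1.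
have hk := negbTE head_lollipop.
rewrite /lollipop_slope /= (can2_eq revK revK) (inj_eq (can_inj revK)).
have [->|h1] := eqVneq h (rev k).
  by rewrite head_rev tail_rev /lollipop_pot hk eqxx /=; lra.
have [->|h2] := eqVneq h k; first by rewrite /lollipop_pot hk eqxx; lra.
case: eqP => [he|he].
  have [-> ->] : head h = tail k /\ tail h = tail k.
    by rewrite /head /tail /= he src_e tgt_e; case: h.2.
  by have : 0 <= c%:~R * len h.1; [rewrite mulr_ge0// ltW|lra].
have ends h' : h'.1 <> e -> h' <> k -> tail h' != tail k.
  move=> e' k'; apply/eqP => tk.
  have : h' \in half_edges (inl (tail k) : gpoint G).
    by rewrite in_half_edges_vertex tk.
  by rewrite lollipop_half_edges !inE => /orP[/orP[]|] /eqP E; rewrite ?E in e' k' *.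
have E1 : tail h != tail k by apply: ends => //; exact/eqP.
have E2 : head h != tail k.
  by apply: ends => //; apply/eqP; rewrite (can2_eq revK revK).
by rewrite /lollipop_pot (negbTE E1) (negbTE E2); lra.
Qed.

Lemma lollipop_canonical : canonical_function (two_slope lollipop_pot lollipop_slope).
Proof.
apply: two_slope_canonical; [exact: lollipop_convex|exact: lollipop_ends|].
move=> v; have [->|vk] := eqVneq v (tail k).
  (* Here the slopes add up to [-1 + 2 * c], and the bound to meet is [3 - 2]. *)
  rewrite val_k lollipop_half_edges.
  have ek b : ((e, b) == k) = false.
    by apply/eqP => E; move/eqP: ke; apply; rewrite -E.
  have erk b : ((e, b) == rev k) = false.
    by apply/eqP => E; move/eqP: ke; apply; rewrite -[k.1]/(rev k).1 -E.
  rewrite -finset.setUA big_setU1 ?inE; last by rewrite ![k == _]eq_sym !ek.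
  rewrite big_setU1 ?inE ?xpair_eqE ?andbF//= big_set1.
  by rewrite /lollipop_slope !eqxx !ek !erk /=; lia.
rewrite (eq_bigr (fun h => if h.1 == e then 0 else lollipop_slope h)); last first.
  move=> h; rewrite in_half_edges_vertex => /eqP hv; case: eqP => // he.
  by move/eqP: vk; case; rewrite -hv /tail he src_e tgt_e; case: h.2.
rewrite (@sum_half_edges_support v k).
  rewrite eq_sym (negbTE vk) add0r /lollipop_slope /= (negbTE ke) eqxx.
  have := val3 v; rewrite (negbTE (introN eqP (@rev_neq _ _ k))).
  by case: (head k == v); lia.
move=> h /eqP/negbTE h1 /eqP/negbTE h2; case: eqP => //.
by rewrite /lollipop_slope h1 h2 => /eqP/negbTE ->.
Qed.

End Lollipop.

End TestFunctions.

(** * Germs cannot all be folded *)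

Section ReducedGraph.
Context {R : realType}.
Variable G : wgraph R.
Hypothesis val3 : forall v, (3 <= valence (inl v : gpoint G))%N.
Implicit Types (h k : edge G * bool) (x y : gpoint G) (u v w : vertex G) (e : edge G).

Lemma loop_third_dart h : tail h = head h ->
  valence (inl (tail h) : gpoint G) = 3%N -> exists k,
    [/\ src h.1 = tail k, tgt h.1 = tail k, k.1 != h.1, tail k = tail h &
        valence (inl (tail k) : gpoint G) = 3%N].
Proof.
move=> loop val.
have : ~~ (half_edges (inl (tail h) : gpoint G) \subset [set h; rev h]%SET).
  apply/negP => /subset_leq_card; rewrite -/(valence _) val cards2.
  by case: (_ == _).
case/fintype.subsetPn => k; rewrite in_half_edges_vertex !inE => /eqP kh.
rewrite negb_or => /andP[/eqP k1 /eqP k2]; exists k; rewrite kh; split=> //.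
- by move: loop; rewrite /head /tail /=; case: h.2.
- by move: loop; rewrite /head /tail /=; case: h.2.
- by apply/eqP => /esym /dart_rev_or[].
Qed.

Lemma exists_unit_slope x h : h \in half_edges x ->
  exists2 g, canonical_function g & germ_affine g x h 1 \/ germ_affine g x h (-1).
Proof.
move=> hx.
(* Whichever affine function prevails at [x], its slope along [h] is [- a h = -1] or
   [a (rev h) = 1], so the position of [x] on the edge does not matter. *)
have unit_germ pv a : canonical_function (two_slope pv a) ->
    (forall h, 0 <= a h + a (rev h)) ->
    (forall h, pv (head h) - (a (rev h))%:~R * len h.1 <= pv (tail h)) ->
    a h = 1 -> a (rev h) = 1 -> exists2 g, canonical_function g &
      germ_affine g x h 1 \/ germ_affine g x h (-1).
  move=> can a1 a2 ah arh; exists (two_slope pv a) => //.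
  have := two_slope_germP a1 a2 hx; rewrite /two_slope_germ ah arh.
  by case: ifP; [right|left].
have [/andP[/eqP loop /eqP val]|nloop] :=
  boolP ((tail h == head h) && (valence (inl (tail h) : gpoint G) == 3%N)).
  have [k [k1 k2 k3 k4 k5]] := loop_third_dart loop val.
  have rk : (h == k) = false /\ (h == rev k) = false.
    by split; apply/eqP => E; move/eqP: k3; apply; rewrite E.
  have rk' : (rev h == k) = false /\ (rev h == rev k) = false.
    by split; apply/eqP => E; move/eqP: k3; apply; rewrite -[h.1]/(rev h).1 E.
  apply: (unit_germ (lollipop_pot k) (lollipop_slope h.1 k 1)).
  - exact: lollipop_canonical.
  - exact: lollipop_convex.
  - exact: lollipop_ends.
  - by rewrite /lollipop_slope rk.1 rk.2 eqxx.
  - by rewrite /lollipop_slope rk'.1 rk'.2 eqxx.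
apply: (unit_germ (fun _ => 0) (peak h 1 1)).
- apply: peak11_canonical => // loop; move: nloop; rewrite loop eqxx /=.
  by have := val3 (head h); lia.
- by move=> h'; rewrite addr_ge0// /peak; do 2 case: ifP => // _.
- move=> h'; rewrite sub0r oppr_le0 mulr_ge0// ?ler0z; last exact/ltW/len_gt0.
  by rewrite /peak; do 2 case: ifP => // _.
- exact: peakl.
- exact: peakr.
Qed.

(* T x h y k: the canonical map identifies the germs of half-edges (x, h) and (y, k). *)
Section Folding.
Variable T : gpoint G -> edge G * bool -> gpoint G -> edge G * bool -> Prop.
Hypothesis T_half_edges : forall x h y k, T x h y k -> k \in half_edges y.
Hypothesis T_eq : forall x h y k g, T x h y k -> canonical_function g ->
  \forall s \near 0^'+, g (ray x h s) = g (ray y k s).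
Hypothesis T_other : forall x h, h \in half_edges x ->
  exists y k, T x h y k /\ (x, h) <> (y, k).
Hypothesis T_lift : forall x h y k h', T x h y k -> (x, h) <> (y, k) ->
  h' \in half_edges x -> exists k', T x h' y k' /\ (x, h') <> (y, k').
Hypothesis card_ge : (#|vertex G| + 2 <= #|edge G|)%N.

(* Otherwise the third edge at the base of the loop is a bridge, on whose points
   the lollipop function is injective. *)
Lemma loop_valence h : tail h = head h ->
  (4 <= valence (inl (tail h) : gpoint G))%N.
Proof.
move=> loop; rewrite leqNgt; apply/negP => val.
have {}val : valence (inl (tail h) : gpoint G) = 3%N by have := val3 (tail h); lia.
have [k [k1 k2 k3 _ k5]] := loop_third_dart loop val.
have kk : k \in half_edges (inl (tail k) : gpoint G) by rewrite in_half_edges_vertex.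
have [y [k' [Tk ne]]] := T_other kk.
have ky := T_half_edges Tk.
have := T_eq Tk (lollipop_canonical val3 (c := 0%N) k1 k2 k3 k5 isT).
have p0 := pos_ge0 ky; have pl := pos_lt ky; have l0 := len_gt0 k.1.
pose d := Num.min (len k.1) (len k'.1 - pos y k') / 2.
have m0 : 0 < Num.min (len k.1) (len k'.1 - pos y k') by rewrite lt_min l0; lra.
have m1 : Num.min (len k.1) (len k'.1 - pos y k') <= len k.1 by rewrite ge_min lexx.
have m2 : Num.min (len k.1) (len k'.1 - pos y k') <= len k'.1 - pos y k'.
  by rewrite ge_min lexx orbT.
have d0 : 0 < d by rewrite /d; lra.
move/(near0_pick d0) => [s [s0 sd]]; rewrite /d in sd.
have lE := two_slopeE (lollipop_ends 0 k1 k2 k3 k5).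
have rkk : (rev k == k) = false by apply/eqP/rev_neq.
have hk := negbTE (head_lollipop k1 k2 k3 k5).
have kE t : two_slope_on (lollipop_pot k) (lollipop_slope h.1 k 0) k t = t - len k.1.
  rewrite /two_slope_on /lollipop_slope !eqxx rkk /lollipop_pot eqxx hk.
  by rewrite max_l; lra.
have kE' t : two_slope_on (lollipop_pot k) (lollipop_slope h.1 k 0) (rev k) t = - t.
  by rewrite two_slope_on_rev kE; lra.
rewrite !ray_dpar !lE; [|lra|rewrite /pos add0r; lra].
rewrite /pos add0r kE -/(pos _ _).
have [kk'|kk'] := eqVneq k.1 k'.1.
  have [E|E] := dart_rev_or kk'.
    subst k'; rewrite kE => E'; apply: ne; congr pair.
    by rewrite -(dpar_pos ky) -dpar0; congr dpar; lra.
  by subst k'; rewrite kE' => E'; move: pl => /=; move: m2; lra.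
have zero b : lollipop_slope h.1 k 0 (k'.1, b) = 0.
  rewrite /lollipop_slope; case: eqP => [E|_].
    by move/eqP: kk'; case; rewrite -E.
  case: eqP => [E|_]; first by move/eqP: kk'; case; rewrite -[k.1]/(rev k).1 -E.
  by case: eqP.
have -> : k' = (k'.1, k'.2) by case: k' {Tk ne ky p0 pl d m0 m1 m2 d0 sd kk' zero}.
rewrite /two_slope_on !zero !mul0r !subr0 /lollipop_pot.
by case: ifP => _; case: ifP => _; rewrite /Num.max; case: ifP => _; lra.
Qed.

(** The function [peak h 1 1] takes the value [- s] at distance [s] from the tail of [h] and
    vanishes off that edge. A germ with the same values must start at an end of the edge and enter
    it. *)
Lemma fold_partner u h y k : h \in half_edges (inl u : gpoint G) ->
  T (inl u) h y k -> (inl u, h) <> (y, k) -> y = inl (head h) /\ k = rev h.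
Proof.
move=> hx Tk ne; have hu : tail h = u by apply/eqP; rewrite -in_half_edges_vertex.
have ky := T_half_edges Tk.
have can := peak11_canonical val3 (@loop_valence h).
have p0 := pos_ge0 ky; have pl := pos_lt ky; have l0 := len_gt0 h.1.
pose m := Num.min (len h.1) (len k.1 - pos y k).
have m0 : 0 < m by rewrite lt_min l0; lra.
have m1 : m <= len h.1 by rewrite ge_min lexx.
have m2 : m <= len k.1 - pos y k by rewrite ge_min lexx orbT.
have d0 : 0 < m / 2 by lra.
have := T_eq Tk can => /(near0_pick d0) [s [s0 sd]].
rewrite !ray_dpar !peakE; [|lra|rewrite /pos add0r; lra].
rewrite peakl peakr !mul1r {1 2}/pos add0r max_l; last by lra.
have [hk|hk] := eqVneq h.1 k.1; last first.
  have zero k' : k'.1 = k.1 -> peak h 1 1 k' = 0.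
    move=> kE; rewrite /peak; case: eqP => [E|_].
      by move/eqP: hk; case; rewrite -kE E.
    by case: eqP => // E; move/eqP: hk; case; rewrite -kE E.
  by rewrite !zero// !mul0r oppr0 maxxx => /eqP; rewrite oppr_eq0 gt_eqF.
have pk : peak h 1 1 k = 1 /\ peak h 1 1 (rev k) = 1.
  by have [->|->] := dart_rev_or hk; rewrite ?revK ?peakl ?peakr.
rewrite pk.1 pk.2 !mul1r => E.
(* The affine function based at the far end of [k] cannot give the value [- s], since [2 * s] is
   less than the distance [len k.1 - pos y k] to that end. *)
have q0 : pos y k = 0.
  by move: E; rewrite /Num.max; case: ifP => _; lra.
have yE : y = inl (tail k) by rewrite -(dpar_pos ky) q0 dpar0.
have [kh|kh] := dart_rev_or hk; last by rewrite yE kh tail_rev.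
by case: ne; rewrite yE kh hu.
Qed.

Lemma folding_false : False.
Proof.
have [u _] := card_gt0P (wgraph_nonempty G).
have inhe h : h \in half_edges (inl (tail h) : gpoint G) by rewrite in_half_edges_vertex.
have fold h : T (inl (tail h)) h (inl (head h)) (rev h).
  have [y [k [Tk ne]]] := T_other (inhe h).
  by have [yE kE] := fold_partner (inhe h) Tk ne; rewrite -yE -kE.
have [h0 h0u] : exists h, h \in half_edges (inl u : gpoint G).
  by apply/set0Pn; rewrite -card_gt0; exact: leq_trans (val3 u).
have {h0u} hu : tail h0 = u by apply/eqP; rewrite -in_half_edges_vertex.
pose w := head h0.
(* Lifting the identification of [h] with [rev h] gives [h1] a partner at [head h], while
   [fold_partner] places it at [head h1]. *)
have all_heads h : forall h1, tail h1 = tail h -> head h1 = head h.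
  move=> h1 th; have ne : (inl (tail h) : gpoint G, h) <> (inl (head h), rev h).
    by case=> _ /esym /rev_neq.
  have h1x : h1 \in half_edges (inl (tail h) : gpoint G).
    by rewrite in_half_edges_vertex th.
  have [k [Tk ne']] := T_lift (fold h) ne h1x.
  by have [[->] _] := fold_partner h1x Tk ne'.
have headu h1 : tail h1 = u -> head h1 = w by move=> tu; apply: all_heads; rewrite hu.
have headw h1 : tail h1 = w -> head h1 = u.
  by move=> tw; rewrite -hu -[tail h0]head_rev; apply: all_heads.
have two v : v = u \/ v = w.
  have /connectP[p + ->] := wgraph_connected u v.
  set r := (X in path X); suff key a : a = u \/ a = w -> path r a p -> last a p = u \/ last a p = w.
    by apply: key; left.
  elim: p a => [//|b p IH] a au /=.
  move=> /andP[/existsP[e eab] pp]; apply: IH pp.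
  have [h [ha <-]] : exists h, tail h = a /\ head h = b.
    case/orP: eab => /andP[/eqP <- /eqP <-]; first by exists (e, false).
    by exists (e, true).
  by case: au => E; [right; apply: headu|left; apply: headw]; rewrite ha.
have card_val v : (forall e, tail (e, false) = v \/ tail (e, true) = v) ->
    (#|edge G| <= valence (inl v : gpoint G))%N.
  move=> ev; rewrite /valence.
  (* One half-edge at [v] is chosen on every edge, the one leaving [src e] whenever this is [v]. *)
  rewrite -(card_imset (f := fun e => (e, src e != v)) predT); last by move=> e e' [].
  apply/subset_leq_card/fintype.subsetP => _ /imsetP[e _ ->].
  rewrite in_half_edges_vertex; case: (src e =P v) (ev e) => [<- _|sv] //=.
  by rewrite /tail /=; case=> // ->.
(* On a rose 5 is needed and the valence is twice the number of edges, at least 6. On a banana graph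
   4 is needed at [u] and 3 at [w], and there are at least 4 edges. *)
have valu v : ((tail h0 == v) * 2 + (head h0 == v) * 1 + 2 <= valence (inl v : gpoint G))%N.
  rewrite hu -/w; have v3 := val3 v.
  have [uw|uw] := eqVneq u w.
    have [uv|_] := eqVneq u v; last by case: eqP uw => [-> /eqP|] //; lia.
    have wv : w = v by rewrite -uw.
    rewrite wv eqxx.
    have -> : valence (inl v : gpoint G) = (#|edge G| * 2)%N.
      rewrite /valence -card_bool -card_prod -cardsT; congr #|pred_of_set _|.
      apply/setP => h; rewrite in_half_edges_vertex inE.
      by apply/eqP; have [->|->] := two (tail h).
    by have : (0 < #|vertex G|)%N := wgraph_nonempty G; lia.
  have V2 : (2 <= #|vertex G|)%N.
    by have := max_card (mem [set u; w]%SET); rewrite cards2 uw.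
  have [uv|uv] := eqVneq u v; have [wv|wv] := eqVneq w v; try lia.
    by move/eqP: uw; rewrite uv wv.
  have : (#|edge G| <= valence (inl v : gpoint G))%N; last by lia.
  apply: card_val => e; rewrite -uv.
  have [|sw] := two (tail (e, false)); first by left.
  by right; rewrite -[(e, true)]/(rev (e, false)) tail_rev; exact: headw.
have can := peak_canonical (p := 2) (q := 1) valu.
have l0 := len_gt0 h0.1.
(* The affine functions of slopes -2 and 1 meet at one third of the edge. Before that, the values at
   distance [s] from tail and head are [- 2 * s] and [- s]. *)
have := T_eq (fold h0) can => /(near0_pick (e := len h0.1 / 3)) [|s [s0 sd]]; first by lra.
rewrite !ray_dpar /pos !add0r !peakE /=; try lra.
rewrite revK peakl peakr !max_l; lra.
Qed.

End Folding.

End ReducedGraph.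

(** * Genus *)

Section Genus.
Context {R : realType}.
Variable G : wgraph R.

(* By connectedness the functions killed by the coboundary are the constants. *)
Lemma rank_boundary_ge : (#|vertex G| <= \rank (boundary_mx G) + 1)%N.
Proof.
rewrite -mxrank_tr.
have : (\rank (kermx (boundary_mx G)^T) <= 1)%N.
  suff sub : (kermx (boundary_mx G)^T <= (const_mx 1 : 'rV[rat]_#|vertex G|))%MS.
    by apply: leq_trans (mxrankS sub) _; exact: rank_leq_row.
  apply/rV_subP => y /sub_kermxP y0.
  have y_edge e : y 0 (enum_rank (tgt e)) = y 0 (enum_rank (src e)).
    have /matrixP/(_ 0 (enum_rank e)) := y0; rewrite !mxE.
    rewrite (eq_bigr (fun j => y 0 j * (j == enum_rank (tgt e))%:R -
                               y 0 j * (j == enum_rank (src e))%:R)); last first.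
      move=> j _; rewrite !mxE mulrBr enum_rankK.
      by rewrite ![_ == enum_val j]eq_sym !(can2_eq enum_valK enum_rankK).
    rewrite big_split /= sumrN (bigD1 (enum_rank (tgt e)))//= eqxx mulr1 big1; last first.
      by move=> j /negbTE ->; rewrite mulr0.
    rewrite (bigD1 (enum_rank (src e)))//= eqxx mulr1 big1; last first.
      by move=> j /negbTE ->; rewrite mulr0.
    by rewrite !addr0 => /eqP; rewrite subr_eq0 => /eqP.
  have [v0 _] := card_gt0P (wgraph_nonempty G).
  have y_const v : y 0 (enum_rank v) = y 0 (enum_rank v0).
    have /connectP[p + ->] := wgraph_connected v0 v.
    set r := (X in path X); suff key a : path r a p ->
      y 0 (enum_rank (last a p)) = y 0 (enum_rank a) by exact: key.
    elim: p a => [//|b p IH] a /= /andP[/existsP[e eab] /IH ->].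
    by case/orP: eab => /andP[/eqP <- /eqP <-].
  apply/submxP; exists (const_mx (y 0 (enum_rank v0))); apply/rowP => j.
  by rewrite !mxE big_ord1 !mxE mulr1 -(enum_valK j) y_const.
by rewrite mxrank_ker leq_subLR.
Qed.

(** The genus is the number of edges minus the rank of the boundary. In this form the assumption
    survives smoothing, which removes one vertex and one edge. *)
Lemma genus_card : (3 <= genus G)%N -> (#|vertex G| + 2 <= #|edge G|)%N.
Proof.
rewrite /genus mxrank_ker; have := rank_boundary_ge.
by set r := \rank _; lia.
Qed.

(** Valence zero is excluded as well: a path from an isolated vertex to an end of some edge has no
    first step. *)
Lemma valence_ge2 : (#|vertex G| + 2 <= #|edge G|)%N ->
  (forall x : gpoint G, valence x <> 1%N) -> forall x : gpoint G, (2 <= valence x)%N.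
Proof.
move=> card_ge no1; case=> [v|p]; last by rewrite /valence half_edges_inner_card.
have := no1 (inl v); case E : (valence _) => [|[|]] // _; exfalso.
have nov e : (src e != v) /\ (tgt e != v).
  have none h : tail h != v.
    apply/negP => hv; have : h \in half_edges (inl v : gpoint G).
      by rewrite in_half_edges_vertex.
    by rewrite (card0_eq E).
  by split; [exact: (none (e, false))|exact: (none (e, true))].
have /card_gt0P[e _] : (0 < #|edge G|)%N by lia.
have /connectP[p + Ep] := wgraph_connected v (src e).
case: p Ep => [/= E'|b p _]; first by have [/eqP[]] := nov e.
move=> /= /andP[/existsP[e' /orP[] /andP[/eqP s /eqP t]] _].
  by have [/eqP[]] := nov e'.
by have [_ /eqP[]] := nov e'.
Qed.

End Genus.

(** * Smoothing vertices of valence two *)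

Section EdgewiseLipschitz.
Context {R : realType} {G G' : wgraph R}.

(** The distance to [theta y], composed with [theta], is 1-Lipschitz along edges, so [gdist_lip]
    applies to it. *)
Lemma gdist_edgewise (theta : gpoint G -> gpoint G') :
  (forall e a b, 0 <= a <= len e -> 0 <= b <= len e ->
     gdist (theta (epar e a)) (theta (epar e b)) <= `|a - b|) ->
  forall x y, gdist (theta x) (theta y) <= gdist x y.
Proof.
move=> lip x y; rewrite -[leLHS]subr0 -(gdistxx (theta y)).
apply: (gdist_lip (g := fun z => gdist (theta z) (theta y))) => e a b ha hb.
rewrite lerBlDr; apply: le_trans (gdist_triangle (theta (epar e b)) _ _) _.
by rewrite lerD2r; exact: lip.
Qed.

End EdgewiseLipschitz.

(* The edge h2.1 is removed and h1.1 becomes the concatenation of h1 and h2,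
   parametrized along h1. *)
Section Smoothing.
Context {R : realType}.
Variable G : wgraph R.
Variables (v : vertex G) (h1 h2 : edge G * bool).
Hypotheses (head_h1 : head h1 = v) (tail_h2 : tail h2 = v) (h12 : h1.1 != h2.1).
Hypothesis darts_v : forall h, tail h = v -> h = rev h1 \/ h = h2.

Lemma smoothing_tail : tail h1 != v.
Proof.
apply/eqP => /darts_v[/esym /rev_neq//|E].
by move/eqP: h12; rewrite E.
Qed.

Lemma smoothing_head : head h2 != v.
Proof.
apply/eqP => /darts_v[E|/rev_neq//].
by move/eqP: h12; case; rewrite -[h2.1]/(rev h2).1 E.
Qed.

Lemma smoothing_other h : h.1 != h1.1 -> h.1 != h2.1 -> tail h != v.
Proof.
by move=> /eqP n1 /eqP n2; apply/eqP => /darts_v[] E; [apply: n1|apply: n2]; rewrite E.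
Qed.

Definition smooth_vertex : finType := {u : vertex G | u != v}.
Definition smooth_edge : finType := {e : edge G | e != h2.1}.

Let a0 : smooth_vertex := exist _ (tail h1) smoothing_tail.
Let e0 : smooth_edge := exist _ h1.1 h12.

(** Only [rev h1] and [h2] start at [v], so none of the ends assigned here and in [smooth_tgt] is
    [v], and the default [a0] is not reached. *)
Definition smooth_src (e : smooth_edge) : smooth_vertex :=
  insubd a0 (if val e == h1.1 then tail h1 else src (val e)).
Definition smooth_tgt (e : smooth_edge) : smooth_vertex :=
  insubd a0 (if val e == h1.1 then head h2 else tgt (val e)).
Definition smooth_len (e : smooth_edge) : R :=
  if val e == h1.1 then len h1.1 + len h2.1 else len (val e).

Lemma smooth_len_gt0 e : 0 < smooth_len e.
Proof. by rewrite /smooth_len; case: ifP => _; rewrite ?addr_gt0 ?len_gt0. Qed.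

Lemma smooth_nonempty : (0 < #|smooth_vertex|)%N.
Proof. by apply/card_gt0P; exists a0. Qed.

Lemma smooth_connected (u w : smooth_vertex) :
  connect (fun a b => [exists e, ((smooth_src e == a) && (smooth_tgt e == b)) ||
                                 ((smooth_src e == b) && (smooth_tgt e == a))]) u w.
Proof.
set r := (X in connect X).
have r_edge e : r (smooth_src e) (smooth_tgt e) /\ r (smooth_tgt e) (smooth_src e).
  by split; apply/existsP; exists e; rewrite !eqxx ?orbT.
(* Here the default matters: it contracts [v] to the tail of [h1], so that a step along [h1] becomes
   trivial and one along [h2] becomes the merged edge. *)
have c_v : insubd a0 v = a0 by rewrite /insubd insubF ?eqxx.
have c_h1 : insubd a0 (tail h1) = a0.
  by apply: val_inj; rewrite val_insubd smoothing_tail.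
have step h : connect r (insubd a0 (tail h)) (insubd a0 (head h)).
  have [E|E1] := eqVneq h1.1 h.1.
    by case: (dart_rev_or E) => ->; rewrite ?head_rev ?tail_rev head_h1 c_v c_h1.
  have [E|E2] := eqVneq h2.1 h.1.
    have [r1 r2] := r_edge e0; move: r1 r2.
    rewrite /smooth_src /smooth_tgt /= eqxx c_h1 => r1 r2.
    by case: (dart_rev_or E) => ->; rewrite ?head_rev ?tail_rev tail_h2 c_v; exact: connect1.
  rewrite eq_sym in E1; rewrite eq_sym in E2.
  have [r1 r2] := r_edge (exist _ h.1 E2); move: r1 r2.
  rewrite /smooth_src /smooth_tgt /= (negbTE E1) => r1 r2.
  by rewrite /head /tail /=; case: h.2; exact: connect1.
suff key (a b : vertex G) : connect r (insubd a0 a) (insubd a0 b).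
  by have := key (val u) (val w); rewrite !valKd.
have /connectP[p + ->] := wgraph_connected a b.
set q := (X in path X); suff key c : path q c p ->
  connect r (insubd a0 c) (insubd a0 (last c p)) by exact: key.
elim: p c => [c _|d p IH c /= /andP[/existsP[e ecd] /IH]]; first exact: connect0.
apply: connect_trans; case/orP: ecd => /andP[/eqP <- /eqP <-].
  exact: (step (e, false)).
exact: (step (e, true)).
Qed.

Definition smoothing : wgraph R :=
  WGraph smooth_len_gt0 smooth_nonempty smooth_connected.

Let E0 : edge smoothing := e0.

Lemma smoothing_card : #|vertex G| = (#|vertex smoothing|).+1 /\
  #|edge G| = (#|edge smoothing|).+1.
Proof.
by split; rewrite card_sig; [rewrite (cardD1 v)|rewrite (cardD1 h2.1)];
  rewrite inE /= add1n; congr _.+1; apply: eq_card => x; rewrite !inE andbT.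
Qed.

Definition smooth_map (z : gpoint G) : gpoint smoothing :=
  match z with
  | inl u => if u == v then epar E0 (len h1.1) else inl (insubd a0 u)
  | inr q =>
    let: (e, t) := sval q in
    if e == h1.1 then epar E0 (if h1.2 then len h1.1 - t else t)
    else if e == h2.1 then epar E0 (len h1.1 + (if h2.2 then len h2.1 - t else t))
    else epar (insubd E0 e : edge smoothing) t
  end.

Definition smooth_inv (z : gpoint smoothing) : gpoint G :=
  match z with
  | inl u => inl (val u)
  | inr q =>
    let: (e, t) := sval q in
    if val e == h1.1 then
      (if t <= len h1.1 then dpar h1 t else dpar h2 (t - len h1.1))
    else epar (val e) t
  end.

Lemma len_E0 : len E0 = len h1.1 + len h2.1.
Proof. by rewrite /= /smooth_len eqxx. Qed.

Lemma smooth_map1 t : 0 <= t <= len h1.1 -> smooth_map (dpar h1 t) = epar E0 t.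
Proof.
move=> ht; have [->|t0] := eqVneq t 0.
  by rewrite dpar0 epar0 /= (negbTE smoothing_tail) /smooth_src eqxx.
have [->|tl] := eqVneq t (len h1.1); first by rewrite dpar1 /= head_h1 eqxx.
have [|q -> qE] := @dpar_inner _ _ h1 t.
  by rewrite !lt_neqAle eq_sym t0 tl.
by rewrite /= qE eqxx; case: h1.2 => //; rewrite subKr.
Qed.

Lemma smooth_map2 t : 0 <= t <= len h2.1 ->
  smooth_map (dpar h2 t) = epar E0 (len h1.1 + t).
Proof.
move=> ht; have [->|t0] := eqVneq t 0; first by rewrite dpar0 /= tail_h2 eqxx addr0.
have [->|tl] := eqVneq t (len h2.1).
  rewrite dpar1 -len_E0 epar1 /= (negbTE smoothing_head).
  by rewrite /smooth_tgt eqxx.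
have [|q -> qE] := @dpar_inner _ _ h2 t.
  by rewrite !lt_neqAle eq_sym t0 tl.
rewrite /= qE eq_sym (negbTE h12) eqxx; case: h2.2 => //.
by rewrite subKr.
Qed.

Lemma smooth_map3 (e : edge smoothing) t : val e != h1.1 -> 0 <= t <= len (val e) ->
  smooth_map (epar (val e) t) = epar e t.
Proof.
move=> ne ht; have ne2 := valP e.
have s1 := smoothing_other (h := (val e, false)) ne ne2.
have s2 := smoothing_other (h := (val e, true)) ne ne2.
have [->|t0] := eqVneq t 0.
  by rewrite !epar0 /= -[src (val e)]/(tail (val e, false)) (negbTE s1) /smooth_src (negbTE ne).
have [tE|tl] := eqVneq t (len (val e)).
  have lE : len e = len (val e) by rewrite /= /smooth_len (negbTE ne).
  rewrite tE epar1 -lE epar1 /= -[tgt (val e)]/(tail (val e, true)) (negbTE s2).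
  by rewrite /smooth_tgt (negbTE ne).
have [|q] := @dpar_inner _ _ (val e, false) t.
  by rewrite !lt_neqAle eq_sym t0 tl.
rewrite /dpar /= => -> qE.
by rewrite /= qE (negbTE ne) (negbTE ne2) valKd.
Qed.

Lemma smooth_inv1 t : 0 <= t <= len h1.1 + len h2.1 -> smooth_inv (epar E0 t) =
  if t <= len h1.1 then dpar h1 t else dpar h2 (t - len h1.1).
Proof.
have l1 := len_gt0 h1.1; have l2 := len_gt0 h2.1.
rewrite -len_E0 => ht; case: (eparP ht) => [->|->|q qE].
- rewrite ltW// dpar0 /= /smooth_src eqxx; congr inl.
  by rewrite val_insubd smoothing_tail.
- rewrite len_E0 leNgt ltrDl l2 /= addrAC subrr add0r dpar1 /smooth_tgt eqxx.
  by congr inl; rewrite val_insubd smoothing_head.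
- by rewrite /= qE /= eqxx.
Qed.

Lemma smooth_inv2 (e : edge smoothing) t : val e != h1.1 -> 0 <= t <= len e ->
  smooth_inv (epar e t) = epar (val e) t.
Proof.
move=> ne ht; have ne2 := valP e.
have s1 := smoothing_other (h := (val e, false)) ne ne2.
have s2 := smoothing_other (h := (val e, true)) ne ne2.
have lE : len e = len (val e) by rewrite /= /smooth_len (negbTE ne).
case: (eparP ht) => [->|->|q qE].
- by rewrite epar0 /= /smooth_src (negbTE ne) val_insubd ifT.
- by rewrite lE epar1 /= /smooth_tgt (negbTE ne) val_insubd ifT.
- by rewrite /= qE /= (negbTE ne).
Qed.

Lemma smooth_ind (P : gpoint G -> Prop) :
  (forall u, u != v -> P (inl u)) ->
  (forall t, 0 <= t <= len h1.1 -> P (dpar h1 t)) ->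
  (forall t, 0 <= t <= len h2.1 -> P (dpar h2 t)) ->
  (forall (e : edge smoothing) t, val e != h1.1 -> 0 <= t <= len (val e) ->
     P (epar (val e) t)) ->
  forall z, P z.
Proof.
move=> P0 P1 P2 P3; apply: gpoint_ind_dpar => [u|h t ht].
  have [->|] := eqVneq u v; last exact: P0.
  by rewrite -tail_h2 -dpar0; apply: P2; rewrite lexx ltW// len_gt0.
have [E|n1] := eqVneq h1.1 h.1.
  case: (dart_rev_or E) => hE; rewrite hE ?dpar_rev; apply: P1; move: ht;
    by rewrite hE /=; lra.
have [E|n2] := eqVneq h2.1 h.1.
  case: (dart_rev_or E) => hE; rewrite hE ?dpar_rev; apply: P2; move: ht;
    by rewrite hE /=; lra.
rewrite eq_sym in n1; rewrite eq_sym in n2.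
rewrite /dpar -[h.1]/(val (exist _ h.1 n2 : edge smoothing)).
by apply: P3 => //=; case: h.2; lra.
Qed.

Lemma smooth_mapK : cancel smooth_map smooth_inv.
Proof.
have l1 := len_gt0 h1.1; have l2 := len_gt0 h2.1.
apply: smooth_ind => [u uv|t ht|t ht|e t ne ht].
- by rewrite /= (negbTE uv) /= val_insubd uv.
- by rewrite smooth_map1// smooth_inv1; [case/andP: ht => _ ->|lra].
- rewrite smooth_map2// smooth_inv1; last by lra.
  have [->|t0] := eqVneq t 0; first by rewrite addr0 lexx dpar1 dpar0 head_h1 tail_h2.
  by rewrite leNgt ltrDl lt_neqAle eq_sym t0 (andP ht).1 /= addrAC subrr add0r.
- by rewrite smooth_map3// smooth_inv2// /= /smooth_len (negbTE ne).
Qed.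

Lemma smooth_map_surj z : exists x, smooth_map x = z.
Proof.
have l1 := len_gt0 h1.1; have l2 := len_gt0 h2.1.
case: z => [u|q].
  by exists (inl (val u)); rewrite /= (negbTE (valP u)) valKd.
rewrite -epar_inner; have := svalP q; case: (sval q) => e t /= /andP[t0 tl].
have [eE|ne] := eqVneq (val e) h1.1; last first.
  exists (epar (val e) t); rewrite smooth_map3//.
  by move: tl; rewrite /smooth_len (negbTE ne); lra.
have -> : e = E0 by exact: val_inj.
move: tl; rewrite /smooth_len eE eqxx => tl.
have [le|gt] := leP t (len h1.1).
  by exists (dpar h1 t); rewrite smooth_map1//; lra.
by exists (dpar h2 (t - len h1.1)); rewrite smooth_map2; [congr epar|]; lra.
Qed.

(** The map and its inverse are both 1-Lipschitz along edges. *)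
Lemma smooth_map_dist x y : gdist (smooth_map x) (smooth_map y) = gdist x y.
Proof.
have l1 := len_gt0 h1.1; have l2 := len_gt0 h2.1.
have E0_dist s t : 0 <= s <= len E0 -> 0 <= t <= len E0 ->
    gdist (epar E0 s) (epar E0 t) <= `|s - t|.
  exact: (@gdist_dpar _ smoothing (E0, false)).
rewrite len_E0 in E0_dist.
apply/eqP; rewrite eq_le; apply/andP; split.
  apply: gdist_edgewise => e a b ha hb.
  have [eE|ne1] := eqVneq e h1.1.
    have epE t : epar e t = dpar h1 (if h1.2 then len e - t else t).
      by rewrite /dpar eE; case: h1.2 => //; rewrite subKr.
    rewrite !epE !smooth_map1 -?eE; try by case: h1.2; lra.
    apply: le_trans (E0_dist _ _ _ _) _; rewrite -?eE; try by case: h1.2; lra.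
    by case: h1.2 => //; rewrite distrC le_eqVlt; apply/orP; left; apply/eqP; congr `|_|; lra.
  have [eE|ne2] := eqVneq e h2.1.
    have epE t : epar e t = dpar h2 (if h2.2 then len e - t else t).
      by rewrite /dpar eE; case: h2.2 => //; rewrite subKr.
    rewrite !epE !smooth_map2 -?eE; try by case: h2.2; lra.
    apply: le_trans (E0_dist _ _ _ _) _; rewrite -?eE; try by case: h2.2; lra.
    case: h2.2; last by rewrite opprD addrACA subrr add0r.
    by rewrite distrC le_eqVlt; apply/orP; left; apply/eqP; congr `|_|; lra.
  pose e' : edge smoothing := exist _ e ne2.
  rewrite -[e]/(val e') !smooth_map3//.
  by apply: (@gdist_dpar _ smoothing (e', false)) => /=; rewrite /smooth_len /= (negbTE ne1).
rewrite -{1}(smooth_mapK x) -{1}(smooth_mapK y).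
apply: gdist_edgewise => e a b; have [eE|ne1] := eqVneq (val e) h1.1; last first.
  move=> ha hb; rewrite !smooth_inv2//; apply: (@gdist_dpar _ G (val e, false));
  by move: ha hb => /=; rewrite /smooth_len (negbTE ne1).
have -> : e = E0 by exact: val_inj.
rewrite len_E0 => ha hb; rewrite !smooth_inv1//.
have mid : dpar h1 (len h1.1) = dpar h2 0 by rewrite dpar1 dpar0 head_h1 tail_h2.
have d1 s t := @gdist_dpar _ G h1 s t; have d2 s t := @gdist_dpar _ G h2 s t.
(* Points on different sides of the smoothed vertex are compared through that vertex. *)
case: (leP a (len h1.1)) => al; case: (leP b (len h1.1)) => bl.
- by apply: d1; lra.
- apply: le_trans (gdist_triangle (dpar h1 (len h1.1)) _ _) _; rewrite {2}mid.
  have := d1 a (len h1.1); have := d2 0 (b - len h1.1).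
  by rewrite !ler0_norm; lra.
- apply: le_trans (gdist_triangle (dpar h2 0) _ _) _; rewrite -{2}mid.
  have := d1 (len h1.1) b; have := d2 (a - len h1.1) 0.
  by rewrite !ger0_norm; lra.
- by rewrite (_ : a - b = (a - len h1.1) - (b - len h1.1)); [apply: d2|]; lra.
Qed.

End Smoothing.

(** Vertices of valence two are smoothed one by one, by induction on the number of vertices; being
    isometries, the smoothings preserve valences. *)
Lemma exists_reduced_model (R : realType) (G : wgraph R) :
  (#|vertex G| + 2 <= #|edge G|)%N -> (forall x : gpoint G, (2 <= valence x)%N) ->
  exists (G' : wgraph R) (theta : gpoint G -> gpoint G'),
    [/\ forall x y, gdist (theta x) (theta y) = gdist x y,
        forall y, exists x, theta x = y,
        forall v, (3 <= valence (inl v : gpoint G'))%N &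
        (#|vertex G'| + 2 <= #|edge G'|)%N].
Proof.
have [n] := ubnP #|vertex G|; elim: n G => // n IH G Gn card_ge val2.
have [/forallP val3|] := boolP [forall v, (3 <= valence (inl v : gpoint G))%N].
  by exists G, id; split=> // y; exists y.
rewrite negb_forall => /existsP[v v2].
have {v2} : #|half_edges (inl v : gpoint G)| == 2.
  by have := val2 (inl v); rewrite /valence in v2 *; lia.
case/cards2P => d [h2 [dh E]].
have hv h : (tail h == v) = (h == d) || (h == h2).
  by rewrite -in_half_edges_vertex E !inE.
have dv : tail d = v by apply/eqP; rewrite hv eqxx.
have h2v : tail h2 = v by apply/eqP; rewrite hv eqxx orbT.
(* If both half-edges at [v] lay on one edge, connectedness would make the graph a circle with a
   single vertex and edge, against [card_ge]. *)
have dh1 : (rev d).1 != h2.1.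
  apply/eqP => /dart_rev_or[]; rewrite ?revK; last by move/esym/eqP; rewrite (negbTE dh).
  move=> h2E; have all_v u : u = v.
    have /connectP[p + ->] := wgraph_connected v u.
    set r := (X in path X); suff key a : a = v -> path r a p -> last a p = v by exact: key.
    elim: p a => [//|b p IHp] a av /= /andP[/existsP[e eab] pp]; apply: IHp pp.
    have [h [ha <-]] : exists h, tail h = a /\ head h = b.
      case/orP: eab => /andP[/eqP <- /eqP <-]; first by exists (e, false).
      by exists (e, true).
    have /eqP := ha; rewrite av hv => /orP[] /eqP ->; last by rewrite h2E head_rev.
    by rewrite -h2v h2E.
  have : (#|edge G| <= 1)%N.
    rewrite -(cards1 d.1); apply: subset_leq_card; apply/fintype.subsetP => e _.
    have /eqP := all_v (tail (e, false)); rewrite hv inE => /orP[] /eqP eE.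
      by rewrite -eE.
    by rewrite -[e]/(e, false).1 eE h2E.
  by have := wgraph_nonempty G; lia.
have darts_v h : tail h = v -> h = rev (rev d) \/ h = h2.
  by move/eqP; rewrite hv revK => /orP[] /eqP; [left|right].
have head_d : head (rev d) = v by rewrite head_rev.
pose G1 := smoothing head_d h2v dh1 darts_v.
have td := smooth_map_dist head_d h2v dh1 darts_v.
have ts : forall z, exists x, smooth_map head_d h2v dh1 darts_v x = z.
  exact: smooth_map_surj.
have [cv ce] := smoothing_card head_d h2v dh1 darts_v.
rewrite -/G1 in cv ce.
have [||x|G2 [th [th1 th2 th3 th4]]] := IH G1; try lia.
  by have [x' <-] := ts x; rewrite isometry_valence.
exists G2, (th \o smooth_map head_d h2v dh1 darts_v); split=> //.
- by move=> x y; rewrite /= th1 td.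
- by move=> y; have [x <-] := th2 y; have [x' <-] := ts x; exists x'.
Qed.

(** * Generators and slopes *)

Section MinimalGenerators.
Context {R : realType}.
Variable G : wgraph R.
Local Open Scope ereal_scope.

(* A generator equal to the constant -oo could be removed. *)
Lemma minimal_generators_finite n (f : 'I_n -> gpoint G -> \bar R) :
  minimal_generating_set (linear_system (canonical_divisor G)) f ->
  exists F : 'I_n -> gpoint G -> R, [/\ f = (fun j => EFin \o F j),
    forall j, canonical_function (F j) &
    forall g, canonical_function g -> exists c : 'I_n -> \bar R,
      (forall j, c j != +oo) /\
      forall x, (g x)%:E = \big[maxe/-oo]_j (c j + (F j x)%:E)].
Proof.
move=> [[fM fgen] fmin].
have key j : exists Fj : gpoint G -> R, f j = EFin \o Fj /\ canonical_function Fj.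
  have [fj|[g gM gE]] := fM j (finset.in_setT j); last first.
    exists g; split=> //; apply/linear_systemP; rewrite gE; exact: fM (finset.in_setT j).
  have : generates (linear_system (canonical_divisor G)) f [set~ j]%SET.
    split=> [i _|g /fgen[c [c1 c2]]]; first exact: fM (finset.in_setT i).
    exists c; split=> // x; rewrite c2 (bigD1 j) ?finset.in_setT//= fj /cst.
    have -> : c j + -oo = -oo by have := c1 j; case: (c j).
    by rewrite maxNye; apply: eq_bigl => i; rewrite !inE.
  by move=> /fmin /setP /(_ j); rewrite !inE eqxx.
have [F FP] := choice key.
have fE : f = (fun j => EFin \o F j) by apply/funext => j; case: (FP j).
exists F; split=> // [j|g /linear_systemP /fgen[c [c1 c2]]]; first by case: (FP j).
exists c; split=> // x; have /= -> := c2 x; apply: eq_big => j; first by rewrite inE.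
by move=> _; case: (FP j) => ->.
Qed.

Lemma bigmaxe_attained n (u : 'I_n -> \bar R) (r : R) :
  r%:E = \big[maxe/-oo]_j u j -> exists j, u j = r%:E.
Proof.
have : \big[maxe/-oo]_j u j = -oo \/ exists j, u j = \big[maxe/-oo]_j u j.
  elim/big_ind: _ => [|x y [->|[i <-]] [->|[j <-]]|j _]; [by left| | | | |by right; exists j].
  - by left; rewrite maxNye.
  - by right; rewrite maxNye; exists j.
  - by right; rewrite maxeNy; exists i.
  - by right; have [le|lt] := leP (u i) (u j); [exists j|exists i].
by case=> [-> //|[j uj]] rE; exists j; rewrite uj rE.
Qed.

Lemma bigmaxe_ge n (u : 'I_n -> \bar R) j : u j <= \big[maxe/-oo]_i u i.
Proof. by rewrite (bigD1 j)//= le_max lexx. Qed.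

End MinimalGenerators.

Lemma canonical_function0 (R : realType) (G : wgraph R) :
  (forall x : gpoint G, (2 <= valence x)%N) ->
  canonical_function (fun _ : gpoint G => 0 : R).
Proof.
move=> val2; have aff x h : germ_affine (fun _ : gpoint G => 0 : R) x h 0.
  by apply/near0E; exists 1 => // s _ _; rewrite mul0r addr0.
split=> [x h _|x]; first by exists 0.
rewrite canonical_divisorE /ord_at big1 => [|h _]; last exact: outgoing_slopeE.
by have := val2 x; lia.
Qed.

Section Slopes.
Context {R : realType}.
Variable G : wgraph R.
Hypothesis card_ge : (#|vertex G| + 2 <= #|edge G|)%N.
Hypothesis val2 : forall x : gpoint G, (2 <= valence x)%N.

Lemma exists_unit_slope_model (x : gpoint G) h : h \in half_edges x ->
  exists2 g, canonical_function g & germ_affine g x h 1 \/ germ_affine g x h (-1).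
Proof.
have [G' [theta [td ts v3 _]]] := exists_reduced_model card_ge val2.
move=> hx; have [k kx kE] := isometry_germ td hx.
have [g gc gk] := exists_unit_slope v3 kx.
exists (g \o theta); first exact: isometry_canonical_function.
by case: gk => gk; [left|right]; exact: isometry_germ_affine kE gk.
Qed.

Variables (n : nat) (F : 'I_n -> gpoint G -> R).
Hypothesis F_canonical : forall j, canonical_function (F j).
Hypothesis F_generates : forall g, canonical_function g -> exists c : 'I_n -> \bar R,
  (forall j, c j != +oo%E) /\
  forall x, (g x)%:E = \big[maxe/-oo%E]_j (c j + (F j x)%:E)%E.

Local Notation f := (fun j => EFin \o F j).

Lemma germ_affine_all x h : h \in half_edges x -> exists m : 'I_n -> int,
  \forall s \near 0^'+, forall j, F j (ray x h s) = F j x + (m j)%:~R * s.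
Proof.
move=> hx; have [m mE] := choice (fun j => (F_canonical j).1 x h hx).
exists m; exact: filter_forall mE.
Qed.

(* The slope of g is realized by a generator attaining the maximum at an
   interior point of a segment on which everything is affine. *)
Lemma slope_of_generator g x h m (mF : 'I_n -> int) : canonical_function g ->
  germ_affine g x h m ->
  (\forall s \near 0^'+, forall j, F j (ray x h s) = F j x + (mF j)%:~R * s) ->
  exists j, mF j = m.
Proof.
move=> gc gm FE; have [c [c1 c2]] := F_generates gc.
have /near0E[d d0 dP] : \forall s \near 0^'+, g (ray x h s) = g x + m%:~R * s /\
    forall j, F j (ray x h s) = F j x + (mF j)%:~R * s.
  by near=> s; split; [near: s|near: s].
pose s := d / 2; have s0 : 0 < s by rewrite /s; lra.
have [||gs Fs] := dP s; [lra|by rewrite /s; lra|].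
have [j] := bigmaxe_attained (c2 (ray x h s)).
case cj : (c j) => [r||] rE; [|by have := c1 j; rewrite cj|by []].
move: rE => /= -[rE].
have le t : 0 < t < d -> (mF j)%:~R * (t - s) <= m%:~R * (t - s) :> R.
  move=> /andP[t0 td]; have [gt Ft] := dP t t0 td.
  have := bigmaxe_ge (fun j => c j + (F j (ray x h t))%:E)%E j.
  rewrite /= -c2 cj -EFinD lee_fin gt Ft; move: rE; rewrite gs Fs.
  rewrite !mulrBr; lra.
exists j; apply/eqP; rewrite -(eqr_int R); apply/eqP.
have l1 := le (s / 2); have l2 := le (s + s / 2).
have h1 : (mF j)%:~R * (- (s / 2)) <= m%:~R * (- (s / 2)) :> R.
  by have := l1; rewrite (_ : s / 2 - s = - (s / 2)); [apply; rewrite /s; lra|lra].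
have h2 : (mF j)%:~R * (s / 2) <= m%:~R * (s / 2) :> R.
  by have := l2; rewrite (_ : s + s / 2 - s = s / 2); [apply; rewrite /s; lra|lra].
have s2 : 0 < s / 2 by lra.
rewrite ler_pM2r// in h2; rewrite !mulrN lerN2 ler_pM2r// in h1.
by apply/eqP; rewrite eq_le h1 h2.
Unshelve. all: by end_near. Qed.

(** Generators realize the slope 0 of a constant and the slope 1 or -1 of a test function. Hence
    slope differences have gcd 1 and lattice length agrees with edge length. *)
Lemma unit_slope_difference x h (mF : 'I_n -> int) : h \in half_edges x ->
  (\forall s \near 0^'+, forall j, F j (ray x h s) = F j x + (mF j)%:~R * s) ->
  exists i j, `|mF j - mF i|%N = 1%N.
Proof.
move=> hx FE; have [g gc g1] := exists_unit_slope_model hx.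
have [i iE] : exists i, mF i = 0.
  apply: slope_of_generator (canonical_function0 val2) _ FE.
  by apply/near0E; exists 1 => // s _ _; rewrite mul0r addr0.
case: g1 => g1; have [j jE] := slope_of_generator gc g1 FE;
  by exists i, j; rewrite iE jE.
Qed.

(** Equal classes mean that all generators differ by one shift [l], hence so do their tropical
    combinations; the constant 0 among these forces [l = 0]. *)
Lemma projective_map_eq x y : projective_map f x = projective_map f y ->
  forall g, canonical_function g -> g x = g y.
Proof.
move=> xy; have : projective_map f y (fun j => f j y).
  by exists 0 => j; rewrite adde0.
rewrite -xy => -[l lE].
have shift g : canonical_function g -> g x = g y + l.
  move=> /F_generates[c [_ c2]]; apply: EFin_inj; rewrite EFinD !c2.
  have morph : {morph (fun u => u + l%:E)%E : u w / maxe u w >-> maxe u w}.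
    by move=> u w; rewrite adde_maxl.
  rewrite (big_morph _ morph (erefl : -oo + l%:E = -oo)%E).
  by apply: eq_bigr => j _; have := lE j; rewrite /= => ->; rewrite addeA.
have l0 := shift _ (canonical_function0 val2); rewrite add0r in l0.
by move=> g /shift; rewrite -l0 addr0.
Qed.

End Slopes.

(** * The metric of the image *)

Section ImageMetric.
Context {R : realType}.
Variable G : wgraph R.
Hypothesis card_ge : (#|vertex G| + 2 <= #|edge G|)%N.
Hypothesis val2 : forall x : gpoint G, (2 <= valence x)%N.
Variables (n : nat) (F : 'I_n -> gpoint G -> R).
Hypothesis F_canonical : forall j, canonical_function (F j).
Hypothesis F_generates : forall g, canonical_function g -> exists c : 'I_n -> \bar R,
  (forall j, c j != +oo%E) /\
  forall x, (g x)%:E = \big[maxe/-oo%E]_j (c j + (F j x)%:E)%E.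

Local Notation f := (fun j => EFin \o F j).
Local Notation phi := (projective_map f).

Lemma biggcd_dvd (w : 'I_n -> int) (d : nat) :
  (forall j, d %| `|w j|)%N -> (d %| \big[gcdn/0%N]_j `|w j|)%N.
Proof.
by move=> dw; elim/big_ind: _ => [|a b da db|j _]; rewrite ?dvdn0 ?dvdn_gcd ?da.
Qed.

Lemma biggcd_eq1 (w : 'I_n -> int) j : `|w j|%N = 1%N ->
  \big[gcdn/0%N]_j `|w j|%N = 1%N.
Proof. by move=> wj; apply/eqP; rewrite -dvdn1 -[X in (_ %| X)%N]wj (bigD1 j)//= dvdn_gcdl. Qed.

Lemma lattice_length_sym (p q : set ('I_n -> \bar R)) (l : R) :
  lattice_length p q l -> lattice_length q p l.
Proof.
move=> [l0 [u [v [pu qv [i [w [w1 wE]]]]]]]; split=> //.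
exists v, u; split=> //; exists i, (fun j => - w j); split.
  by rewrite -w1; apply: eq_bigr => j _; rewrite abszN.
by move=> j; have := wE j; rewrite mulrNz; lra.
Qed.

Lemma image_step_sym p q l : image_step f p q l -> image_step f q p l.
Proof.
move=> [e [a [b [[ha hb lin pE qE] pql]]]]; exists e, b, a; split.
  by split=> // j; rewrite minC maxC; exact: lin.
by case: pql => [[-> ->]|ll]; [left|right; exact: lattice_length_sym].
Qed.

Lemma image_step_ge0 p q l : image_step f p q l -> 0 <= l.
Proof. by move=> [e [a [b [_ [[_ ->]//|[/ltW]]]]]]. Qed.

Lemma image_step_dpar h p s (m : 'I_n -> int) :
  0 <= p -> 0 < s -> p + s <= len h.1 ->
  (forall t, 0 <= t <= s -> forall j, F j (dpar h (p + t)) = F j (dpar h p) + (m j)%:~R * t) ->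
  (exists i j, `|m j - m i|%N = 1%N) ->
  image_step f (phi (dpar h p)) (phi (dpar h (p + s))) s.
Proof.
move=> p0 s0 ps lin [i [j mij]].
pose par t := if h.2 then len h.1 - t else t.
have dE t : dpar h t = epar h.1 (par t) by [].
exists h.1, (par p), (par (p + s)); split.
  split=> //; [by rewrite /par; case: h.2; lra|by rewrite /par; case: h.2; lra|].
  move=> k; pose b : R := if h.2 then -1 else 1.
  exists (F k (dpar h p) + (m k)%:~R * (b * (0 - par p))), ((m k)%:~R * b) => t ht.
  have parK : epar h.1 t = dpar h (par t).
    by rewrite /dpar /par; case: h.2 => //; rewrite subKr.
  have tE : par t = p + b * (t - par p).
    by rewrite /b /par; case: h.2; lra.
  have bt : 0 <= b * (t - par p) <= s.
    move: ht; rewrite /b /par; case: h.2.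
      by rewrite min_r ?max_l; lra.
    by rewrite min_l ?max_r; lra.
  rewrite /= parK tE lin//; congr EFin; lra.
right; split=> //; exists (F ^~ (dpar h p)), (F ^~ (dpar h (p + s))); split=> //.
(* The entry at [j] is 1 or -1, so this integer vector is primitive and the lattice length is [s]
   itself. *)
exists i, (fun k => m i - m k); split.
  by apply: (@biggcd_eq1 _ j); rewrite -abszN opprB.
move=> k; rewrite !lin; try by rewrite lexx ltW.
by rewrite intrB; lra.
Qed.

Lemma germ_image_step h p : 0 <= p < len h.1 ->
  exists2 d : R, 0 < d & forall s, 0 < s -> s < d -> p + s <= len h.1 ->
    image_step f (phi (dpar h p)) (phi (dpar h (p + s))) s.
Proof.
move=> hp; have hx := half_edges_dpar hp.
have [m mE] := germ_affine_all F_canonical hx.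
have diff := unit_slope_difference card_ge val2 F_generates hx mE.
have /near0E[d d0 dP] := mE; exists d => // s s0 sd ps.
apply: image_step_dpar diff => //; first by case/andP: hp.
move=> t /andP[]; rewrite le_eqVlt => /orP[/eqP <- _ j|t0 ts j].
  by rewrite addr0 mulr0 addr0.
by have := dP t t0 (le_lt_trans ts sd) j; rewrite ray_dpar pos_dpar.
Qed.

(** Sufficiently short segments on either side of each point are image steps of their own length;
    [interval_induction] chains them. *)
Lemma edge_image_chain e a b : 0 <= a -> a <= b -> b <= len e ->
  schain (image_step f) (phi (epar e a)) (phi (epar e b)) (b - a).
Proof.
move=> a0 ab bl.
apply: (@interval_induction R (fun a b =>
  schain (image_step f) (phi (epar e a)) (phi (epar e b)) (b - a))) => //.
- by move=> t; rewrite subrr; exact: chain_nil.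
- move=> x y z cxy cyz; rewrite (_ : z - x = (y - x) + (z - y)); last by lra.
  exact: chain_cat cxy cyz.
- move=> t ht; have [|d d0 dP] := @germ_image_step (e, false) t; first by rewrite /=; lra.
  exists d => // t' ht' t'b; rewrite -[X in schain _ _ _ X]addr0.
  apply: chain_cons (chain_nil _ _).
  have := dP (t' - t); rewrite /dpar /= (_ : t + (t' - t) = t'); last by lra.
  by apply; lra.
- move=> t ht; have [|d d0 dP] := @germ_image_step (e, true) (len e - t).
    by rewrite /=; lra.
  exists d => // t' ht' t'b; rewrite -[X in schain _ _ _ X]addr0.
  apply: chain_cons (chain_nil _ _); apply: image_step_sym.
  have := dP (t - t'); rewrite /dpar /= subKr.
  rewrite (_ : len e - (len e - t + (t - t')) = t'); last by lra.
  by apply; lra.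
Qed.

Lemma image_chain x y l : schain (edge_step (G := G)) x y l ->
  schain (image_step f) (phi x) (phi y) l.
Proof.
elim=> [u|u v w a b [e [s [t [hs ht -> -> ->]]]] _ IH]; first exact: chain_nil.
apply: chain_cat IH; have [st|ts] := leP s t.
  by rewrite ler0_norm ?opprB; [apply: edge_image_chain|]; lra.
rewrite gtr0_norm; last by lra.
apply: chain_sym; first exact: image_step_sym.
by apply: edge_image_chain; lra.
Qed.

Lemma image_chain_lbound p q : has_lbound [set l : R | schain (image_step f) p q l].
Proof. by exists 0 => l /(chain_ge0 image_step_ge0). Qed.

Lemma image_dist_le x y : image_dist f (phi x) (phi y) <= gdist x y.
Proof.
apply: gdist_ge => l /image_chain c; apply: ge_inf => //.
exact: image_chain_lbound.
Qed.

Lemma linear_on_slopes e a b : a < b -> 0 <= a -> b <= len e -> linear_on f e a b ->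
  exists m : 'I_n -> int,
    (forall j, F j (epar e b) - F j (epar e a) = (m j)%:~R * (b - a)) /\
    exists i j, `|m j - m i|%N = 1%N.
Proof.
move=> ab a0 bl lin; have ha : 0 <= a < len (e, false).1 by rewrite /=; lra.
have hx := half_edges_dpar ha.
have [m mE] := germ_affine_all F_canonical hx.
have diff := unit_slope_difference card_ge val2 F_generates hx mE.
exists m; split; last exact: diff.
have ba : 0 < b - a by lra.
have [s [s0 sba sE]] := near0_pick ba mE.
move=> j; have [c [k ck]] := lin j; have := sE j.
rewrite ray_dpar pos_dpar// /dpar /=.
have FE t : a <= t <= b -> F j (epar e t) = c + k * t.
  by move=> ht; apply: EFin_inj; apply: ck; rewrite min_l ?max_r; lra.
rewrite !FE; try lra; move=> E.
have -> : k = (m j)%:~R.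
  have s0' : s != 0 by rewrite gt_eqF.
  by apply: (mulIf s0'); lra.
by lra.
Qed.

(** The same difference vector is [l] times the primitive [w] and [b - a] times a vector of slope
    differences. As two slopes differ by one, [b - a] is up to sign [l * k] for a difference [k] of
    entries of [w]; then [k] divides all of [w], so it is 1 or -1. *)
Lemma lattice_length_edge e a b l : 0 <= a -> b <= len e -> a <= b -> linear_on f e a b ->
  lattice_length (phi (epar e a)) (phi (epar e b)) l -> b - a <= l.
Proof.
move=> a0 bl; rewrite le_eqVlt => /orP[/eqP <- _ [l0 _]|ab lin]; first by lra.
move=> [l0 [u [v [pu qv [i [w [w1 wE]]]]]]].
have rep x (u' : 'I_n -> R) : phi x = tproj (EFin \o u') ->
    exists c : R, forall j, u' j = F j x + c.
  move=> E; have : tproj (EFin \o u') (EFin \o u').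
    by exists 0 => j; rewrite adde0.
  rewrite -E => -[c cE]; exists (- c) => j.
  by have := cE j; rewrite /= -EFinD => -[->]; rewrite addrK.
have [c cE] := rep _ _ pu; have [c' cE'] := rep _ _ qv.
have [m [mE [i0 [j0 ij]]]] := linear_on_slopes ab a0 bl lin.
have {wE} wE j : l * (w j)%:~R = (m i - m j)%:~R * (b - a).
  rewrite -wE !cE !cE' intrB mulrBl -!mE; lra.
pose k := w j0 - w i0.
have kE : (b - a = l * k%:~R \/ b - a = - (l * k%:~R)).
  have : l * k%:~R = (m i0 - m j0)%:~R * (b - a).
    by rewrite /k intrB mulrBr !wE !intrB; lra.
  have [mm|mm] : m i0 - m j0 = 1 \/ m i0 - m j0 = -1 by lia.
    by rewrite mm mul1r; left.
  by rewrite mm mulN1r; right; lra.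
have kw j : (`|k| %| `|w j|)%N.
  have [r wr] : exists r : int, w j = r * k.
    case: kE => kE; [exists (m i - m j)|exists (m j - m i)].
      apply/eqP; rewrite -(eqr_int R); apply/eqP; apply: (mulfI (lt0r_neq0 l0)).
      by rewrite wE kE intrM; lra.
    apply/eqP; rewrite -(eqr_int R); apply/eqP; apply: (mulfI (lt0r_neq0 l0)).
    by rewrite wE kE intrM !intrB; lra.
  by rewrite wr abszM dvdn_mull.
have k1 : `|k|%N = 1%N by apply/eqP; rewrite -dvdn1 -w1; exact: biggcd_dvd.
have [kk|kk] : k = 1 \/ k = -1 by lia.
  by case: kE => ->; rewrite kk; lra.
by case: kE => ->; rewrite kk; lra.
Qed.

Hypothesis phi_inj : injective phi.

(** By injectivity consecutive image steps lift to segments with matching ends, each no longer than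
    its lattice length. *)
Lemma image_dist_ge x y : gdist x y <= image_dist f (phi x) (phi y).
Proof.
apply: lb_le_inf.
  by have [l c] := chain_exists x y; exists l; exact: image_chain.
move=> l c; have key p q l' : schain (image_step f) p q l' ->
    forall x, phi x = p -> forall y, phi y = q -> gdist x y <= l'.
  elim=> {p q l'} [p x' xp y' yp|p q r l1 l2 step _ IH x' xp y' yr].
    by rewrite (phi_inj (etrans xp (esym yp))) gdistxx.
  have [e [a [b [[ha hb lin pE qE] pql]]]] := step.
  apply: le_trans (gdist_triangle (epar e b) _ _) _; apply: lerD; last exact: IH.
  have -> : x' = epar e a by apply: phi_inj; rewrite xp.
  case: pql => [[pq ->]|ll].
    by rewrite (phi_inj (etrans (esym pE) (etrans pq qE))) gdistxx.
  have [ab|ba] := leP a b.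
    apply: le_trans (@gdist_dpar _ _ (e, false) _ _ ha hb) _.
    rewrite ler0_norm ?opprB; last by lra.
    apply: lattice_length_edge lin _ => //; [by case/andP: ha|by case/andP: hb|].
    by rewrite -pE -qE.
  apply: le_trans (@gdist_dpar _ _ (e, false) _ _ ha hb) _.
  rewrite gtr0_norm; last by lra.
  apply: (@lattice_length_edge e b a); [by case/andP: hb|by case/andP: ha|exact: ltW| |].
    by move=> j; have := lin j; rewrite minC maxC.
  by rewrite -pE -qE; exact: lattice_length_sym.
exact: key c _ erefl _ erefl.
Qed.

Lemma injective_is_harmonic :
  is_harmonic [set: gpoint G] (@mdist R (gpoint G)) (range phi) (image_dist f) phi.
Proof.
exists G, G, id, phi, id, (fun _ => 1%N); split=> //.
- by split=> //; split=> // [x y _ _ //|y _]; exists y.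
- split; last first.
    move=> x y; apply/eqP; rewrite eq_le.
    by apply/andP; split; [exact: image_dist_le|exact: image_dist_ge].
  by split; [move=> x _; exists x|move=> x y _ _; exact: phi_inj|move=> y [x _ <-]; exists x].
- split.
  + by move=> x; exact: cvg_id.
  + by move=> v; exists v.
  + move=> e'; exists [set e']%SET; rewrite preimage_id.
    apply/seteqP; split=> [x ex|x [e /=]]; first by exists e' => //=; rewrite inE.
    by rewrite inE => /eqP ->.
  + move=> e; right; exists e, false, 0 => t ht.
    by rewrite expr0 !mul1r add0r.
- move=> x; exists 1%N => h' hx'.
  rewrite (big_pred1 h')// => h /=; apply/andP/eqP => [[hx /asboolP[c c0 /near0E[d d0 dP]]]|->].
    have r0 := star_radius_gt0 x.
    pose m := Num.min d (star_radius x / (c + 1)).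
    have m0 : 0 < m by rewrite lt_min d0 divr_gt0//; lra.
    have m1 : m <= d by rewrite ge_min lexx.
    have m2 : m <= star_radius x / (c + 1) by rewrite ge_min lexx orbT.
    rewrite ler_pdivlMr in m2; last by lra.
    have mc : 0 < m * c by rewrite mulr_gt0.
    have E := dP (m / 2) ltac:(lra) ltac:(lra).
    (* Comparing distances to [x] forces the factor [c] of the germ to be one. *)
    have cs : c * (m / 2) = m / 2.
      rewrite -(@gdist_base_ray _ _ x h' (c * (m / 2))) -?E ?gdist_base_ray//; lra.
    by apply: (@ray_inj _ _ x h h' (m / 2)) => //; [lra|rewrite E cs].
  split=> //; apply/asboolP; exists 1 => //.
  by apply/near0E; exists 1 => // s _ _; rewrite mul1r.
Qed.

End ImageMetric.

(** * Coverings of graphs *)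

Section GermInjectivity.
Context {R : realType}.
Variable G : wgraph R.

Lemma germ_inj (x y : gpoint G) h k : h \in half_edges x -> k \in half_edges y ->
  (\forall s \near 0^'+, ray x h s = ray y k s) -> x = y /\ h = k.
Proof.
move=> hx ky; have p0 := pos_ge0 hx; have pl := pos_lt hx.
have q0 := pos_ge0 ky; have ql := pos_lt ky.
(* Rays running towards one another on the same edge meet for the single value of [s] with
   [2 * s = len h.1 - pos x h - pos y k]; the choice of [d] keeps [s] below it, and 1 is a dummy
   when they do not meet. *)
pose d := if 0 < len h.1 - pos x h - pos y k then len h.1 - pos x h - pos y k else 1.
have d0 : 0 < d by rewrite /d; case: ifP.
pose m := Num.min (Num.min (len h.1 - pos x h) (len k.1 - pos y k)) (d / 2).
have m0 : 0 < m by rewrite !lt_min; lra.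
have m1 : m <= len h.1 - pos x h by rewrite !ge_min lexx.
have m2 : m <= len k.1 - pos y k by rewrite !ge_min lexx orbT.
have m3 : m <= d / 2 by rewrite !ge_min lexx !orbT.
move=> /(near0_pick m0)[s [s0 sm]]; rewrite !ray_dpar.
case/dpar_inj; [lra|lra| |] => -[kh st].
  subst k; split=> //; rewrite -(dpar_pos hx) -(dpar_pos ky).
  by congr dpar; lra.
by exfalso; move: m3; rewrite /d; case: ltP => ?; lra.
Qed.

End GermInjectivity.

Section Covering.
Context {R : realType}.
Variables (H H' : wgraph R) (psi : gpoint H -> gpoint H').
Variable Psi : edge H * bool -> edge H' * bool.
Hypothesis Psi_rev : forall h, Psi (rev h) = rev (Psi h).
Hypothesis Psi_len : forall h, len (Psi h).1 = len h.1.
Hypothesis psi_dpar : forall h (t : R), 0 <= t <= len h.1 -> psi (dpar h t) = dpar (Psi h) t.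

Definition fiber_at (v : vertex H) (h' : edge H' * bool) : {set edge H * bool} :=
  [set h | (tail h == v) && (Psi h == h')].

Hypothesis fiber_at_eq : forall v h1 h2,
  psi (inl v) = inl (tail h1) -> psi (inl v) = inl (tail h2) ->
  #|fiber_at v h1| = #|fiber_at v h2|.

Lemma psi_tail h : psi (inl (tail h)) = inl (tail (Psi h)).
Proof. by rewrite -dpar0 psi_dpar ?dpar0// lexx ltW// len_gt0. Qed.

Lemma card_fiber h' : #|[set h | Psi h == h']%SET| = (\sum_v #|fiber_at v h'|)%N.
Proof.
rewrite -sum1_card (partition_big (@tail _ H) predT)//=; apply: eq_bigr => v _.
by rewrite -sum1_card; apply: eq_bigl => h; rewrite !inE andbC.
Qed.

(** The fiber is summed over vertices of [H]: those above the common tail contribute equally by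
    harmonicity, the others nothing. *)
Lemma card_fiber_tail h1 h2 : tail h1 = tail h2 ->
  #|[set h | Psi h == h1]%SET| = #|[set h | Psi h == h2]%SET|.
Proof.
move=> h12; rewrite !card_fiber; apply: eq_bigr => v _.
have [v1|v1] := eqVneq (psi (inl v)) (inl (tail h1)).
  by apply: fiber_at_eq => //; rewrite -h12.
have empty h' : tail h' = tail h1 -> #|fiber_at v h'| = 0%N.
  move=> t'; apply: eq_card0 => h; rewrite inE; apply/negP => /andP[/eqP hv /eqP hh].
  by move/eqP: v1; case; rewrite -hv psi_tail hh t'.
by rewrite !empty.
Qed.

Lemma card_fiber_rev h' : #|[set h | Psi h == rev h']%SET| = #|[set h | Psi h == h']%SET|.
Proof.
rewrite -(card_imset _ (inv_inj (@revK _ H))); apply: eq_card => h.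
rewrite inE; apply/imsetP/eqP => [[k + ->]|hh].
  by rewrite inE Psi_rev => /eqP ->; rewrite revK.
by exists (rev h); rewrite ?revK// inE Psi_rev hh.
Qed.

(** Along a path, reversal crosses an edge and [card_fiber_tail] turns at a vertex; the common value
    is the degree of the covering. *)
Lemma card_fiber_const h1 h2 :
  #|[set h | Psi h == h1]%SET| = #|[set h | Psi h == h2]%SET|.
Proof.
have /connectP[p + E] := wgraph_connected (tail h1) (tail h2).
set r := (X in path X).
suff key a : (forall h', tail h' = a ->
    #|[set h | Psi h == h']%SET| = #|[set h | Psi h == h1]%SET|) -> path r a p ->
    forall h', tail h' = last a p ->
    #|[set h | Psi h == h']%SET| = #|[set h | Psi h == h1]%SET|.
  by move=> pp; apply/esym/(key (tail h1)) => // h' /card_fiber_tail.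
elim: p a {E} => [//|b p IH] a ha /= /andP[/existsP[e eab] pp]; apply: IH pp.
have [k [ka kb]] : exists k, tail k = a /\ head k = b.
  case/orP: eab => /andP[/eqP <- /eqP <-]; first by exists (e, false).
  by exists (e, true).
by move=> h' hb; rewrite (card_fiber_tail (h2 := rev k)) ?hb -?kb// card_fiber_rev ha.
Qed.

Lemma fiber_eq2 h k : h <> k -> Psi h = Psi k -> (2 <= #|[set h' | Psi h' == Psi h]%SET|)%N.
Proof.
move=> /eqP hk E; rewrite -[2%N]/(true.+1) -[true]hk -cards2.
by apply/subset_leq_card/fintype.subsetP => l; rewrite !inE => /orP[] /eqP ->; rewrite ?E.
Qed.

Hypothesis half_edge_exists : forall x : gpoint H, exists h, h \in half_edges x.

(** If one of the points is interior, two oriented edges lie over the same one. For two vertices,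
    harmonicity supplies at the second one a half-edge over the image of [h]. *)
Lemma not_injective_fiber2 x y : psi x = psi y -> x <> y ->
  exists h', (2 <= #|[set h | Psi h == h']%SET|)%N.
Proof.
have [h hx] := half_edge_exists x; have [k ky] := half_edge_exists y.
have p0 := pos_ge0 hx; have pl := pos_lt hx.
have q0 := pos_ge0 ky; have ql := pos_lt ky.
rewrite -(dpar_pos hx) -(dpar_pos ky).
move: (pos x h) (pos y k) p0 pl q0 ql => p q p0 pl q0 ql {hx ky x y}.
have inner h1 h2 (p1 p2 : R) : 0 < p1 < len h1.1 -> 0 <= p2 <= len h2.1 ->
    dpar (Psi h1) p1 = dpar (Psi h2) p2 -> dpar h1 p1 <> dpar h2 p2 ->
    exists h', (2 <= #|[set h | Psi h == h']%SET|)%N.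
  rewrite -{1}Psi_len => hp1 hp2 E ne; exists (Psi h1).
  case: (dpar_inj hp1 _ E) => [|[E1 E2]|[E1 E2]]; first by rewrite Psi_len.
    by apply: (@fiber_eq2 h1 h2) => // h12; apply: ne; rewrite h12 E2.
  apply: (@fiber_eq2 h1 (rev h2)); last by rewrite Psi_rev E1 revK.
  move=> h12; apply: ne; rewrite h12 dpar_rev; congr dpar.
  by rewrite E2 Psi_len h12 /=; lra.
rewrite !psi_dpar; [move=> E ne|lra|lra].
have [p1|p1] := ltP 0 p; first by apply: inner E ne; lra.
have [q1|q1] := ltP 0 q.
  by apply: (inner k h q p); [lra|lra|exact: esym|move=> F; apply: ne].
have pE : p = 0 by lra.
have qE : q = 0 by lra.
move: E ne; rewrite pE qE !dpar0 => -[E] ne.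
have : (0 < #|fiber_at (tail k) (Psi h)|)%N.
  rewrite (@fiber_at_eq _ _ (Psi k)) ?psi_tail ?E//.
  by apply/card_gt0P; exists k; rewrite inE !eqxx.
case/card_gt0P => k'; rewrite inE => /andP[/eqP k't /eqP k'E].
exists (Psi h); apply: (@fiber_eq2 h k') => // hk; apply: ne.
by rewrite hk k't.
Qed.

(** At an interior point [h1] is [h] or [rev h], matched with [k] or [rev k]. At a vertex the fibers
    over [Psi h1] and [Psi k] at [tail k] have the same size: nonempty in general, and at least two
    when [h] and [k] share their tail, which leaves a choice other than [h1]. *)
Lemma lift_germ x h y k h1 : h \in half_edges x -> k \in half_edges y ->
  (\forall s \near 0^'+, psi (ray x h s) = psi (ray y k s)) -> (x, h) <> (y, k) ->
  h1 \in half_edges x -> exists k1, [/\ k1 \in half_edges y,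
    \forall s \near 0^'+, psi (ray x h1 s) = psi (ray y k1 s) & (x, h1) <> (y, k1)].
Proof.
move=> hx ky hk ne h1x.
have p0 := pos_ge0 hx; have pl := pos_lt hx.
have q0 := pos_ge0 ky; have ql := pos_lt ky.
have psi_ray z l : l \in half_edges z ->
    \forall s \near 0^'+, psi (ray z l s) = dpar (Psi l) (pos z l + s).
  move=> lz; have r0 := pos_ge0 lz; have rl := pos_lt lz.
  apply/near0E; exists (len l.1 - pos z l); first by lra.
  by move=> s s0 sl; rewrite ray_dpar psi_dpar//; lra.
have same_psi z l z' l' : l \in half_edges z -> l' \in half_edges z' ->
    Psi l = Psi l' -> pos z l = pos z' l' ->
    \forall s \near 0^'+, psi (ray z l s) = psi (ray z' l' s).
  move=> lz lz' El Ep; near=> s.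
  rewrite (near (psi_ray _ _ lz) s)// (near (psi_ray _ _ lz') s)// El Ep.
  by [].
have [PE pE] : Psi h = Psi k /\ pos x h = pos y k.
  have hp : 0 <= pos x h < len (Psi h).1 by rewrite Psi_len p0 pl.
  have kq : 0 <= pos y k < len (Psi k).1 by rewrite Psi_len q0 ql.
  have [|E1 E2] := germ_inj (half_edges_dpar hp) (half_edges_dpar kq).
    near=> s; rewrite !ray_dpar !pos_dpar//.
    rewrite -(near (psi_ray _ _ hx) s)// -(near (psi_ray _ _ ky) s)//.
    by near: s.
  by split=> //; rewrite -(pos_dpar hp) E1 E2 pos_dpar.
have hk' : h <> k.
  by move=> E; apply: ne; rewrite -(dpar_pos hx) -(dpar_pos ky) pE E.
have [p1|p1] := ltP 0 (pos x h).
  have [|xi xE xs] := @dpar_inner _ _ h (pos x h); first by rewrite p1 pl.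
  rewrite dpar_pos// in xE.
  have [|yi yE ys] := @dpar_inner _ _ k (pos y k); first by rewrite ql -pE p1.
  rewrite dpar_pos// in yE.
  have h11 : h.1 = h1.1.
    by move: h1x; rewrite xE in_half_edges_inner xs => /eqP.
  case: (dart_rev_or h11) => ->; first by exists k; split=> //; exact: same_psi.
  have rhx : rev h \in half_edges x.
    by rewrite xE in_half_edges_inner xs.
  have rky : rev k \in half_edges y.
    by rewrite yE in_half_edges_inner ys.
  exists (rev k); split=> //; last first.
    by move=> /(congr1 snd) E; apply: hk'; exact: (inv_inj revK E).
  apply: same_psi => //; first by rewrite !Psi_rev PE.
  have lhk : len h.1 = len k.1 by rewrite -!Psi_len PE.
  move: pE; rewrite {hx ky hk ne h1x p0 pl q0 ql p1 rhx rky} xE yE /= xs ys /= -!lhk.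
  by case: h.2; case: k.2 => /=; lra.
have px0 : pos x h = 0 by lra.
have xE : x = inl (tail h) by rewrite -(dpar_pos hx) px0 dpar0.
have yE : y = inl (tail k) by rewrite -(dpar_pos ky) -pE px0 dpar0.
have th1 : tail h1 = tail h.
  by apply/eqP; rewrite -in_half_edges_vertex -xE.
have tP : tail (Psi h1) = tail (Psi h).
  by apply: (@inl_inj _ {p : edge H' * R | 0 < p.2 < len p.1}); rewrite -!psi_tail th1.
have cnt : #|fiber_at (tail k) (Psi h1)| = #|fiber_at (tail k) (Psi k)|.
  by apply: fiber_at_eq; rewrite psi_tail// tP PE.
have kin : k \in fiber_at (tail k) (Psi k) by rewrite inE !eqxx.
suff [k1] : exists k1, k1 \in fiber_at (tail k) (Psi h1) /\ (x, h1) <> (y, k1).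
  rewrite inE => -[/andP[/eqP k1t /eqP k1E] ne1].
  have k1y : k1 \in half_edges y by rewrite yE in_half_edges_vertex k1t.
  exists k1; split=> //; apply: same_psi => //.
  by rewrite xE yE.
have [hkt|hkt] := eqVneq (tail h) (tail k); last first.
  have /card_gt0P[k1 k1P] : (0 < #|fiber_at (tail k) (Psi h1)|)%N.
    by rewrite cnt; apply/card_gt0P; exists k.
  by exists k1; split=> //; rewrite xE yE => -[E]; rewrite E eqxx in hkt.
have : ~~ (fiber_at (tail k) (Psi h1) \subset [set h1]%SET).
  apply/negP => /subset_leq_card; rewrite cards1 cnt leqNgt => /negP; apply.
  rewrite -[2%N]/(true.+1) -[true](introN eqP hk') -cards2.
  apply/subset_leq_card/fintype.subsetP => l; rewrite !inE => /orP[] /eqP ->.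
    by rewrite hkt PE !eqxx.
  by rewrite !eqxx.
case/fintype.subsetPn => k1 k1P; rewrite inE => /eqP k1h; exists k1; split=> //.
by case=> _ /esym.
Unshelve. all: by end_near. Qed.

End Covering.

(** * Harmonic canonical maps *)

Section HarmonicInjective.
Context {R : realType}.
Variable G : wgraph R.
Hypothesis card_ge : (#|vertex G| + 2 <= #|edge G|)%N.
Hypothesis val2 : forall x : gpoint G, (2 <= valence x)%N.
Variables (n : nat) (F : 'I_n -> gpoint G -> R).
Hypothesis F_canonical : forall j, canonical_function (F j).
Hypothesis F_generates : forall g, canonical_function g -> exists c : 'I_n -> \bar R,
  (forall j, c j != +oo%E) /\
  forall x, (g x)%:E = \big[maxe/-oo%E]_j (c j + (F j x)%:E)%E.

Local Notation f := (fun j => EFin \o F j).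
Local Notation phi := (projective_map f).

Variables (H H' : wgraph R) (i : gpoint H -> gpoint G)
  (i' : gpoint H' -> set ('I_n -> \bar R)) (psi : gpoint H -> gpoint H')
  (deg : edge H -> nat).
Hypothesis i_dist : forall x y, gdist (i x) (i y) = gdist x y.
Hypothesis i_surj : forall y, exists x, i x = y.
Hypothesis i'_dist : forall x y, image_dist f (i' x) (i' y) = gdist x y.
Hypothesis i'_inj : injective i'.
Hypothesis psiE : forall x, i' (psi x) = phi (i x).
Hypothesis psi_vertex : forall v, exists v', psi (inl v) = inl v'.
Hypothesis psi_dilation : forall e, dilation psi e (deg e).
Hypothesis psi_harmonic : forall x, harmonic_at psi deg x.

Lemma psi_canonical x y g : psi x = psi y -> canonical_function g -> g (i x) = g (i y).
Proof.
move=> xy gc; have E : phi (i x) = phi (i y) by rewrite -!psiE xy.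
exact: (projective_map_eq val2 F_generates E gc).
Qed.

Lemma psi_lipschitz x y : gdist (psi x) (psi y) <= gdist x y.
Proof.
rewrite -i'_dist !psiE -i_dist.
exact: (image_dist_le card_ge val2 F_canonical F_generates).
Qed.

(** On a collapsed edge every canonical function would be constant, contrary to the existence of one
    of slope 1 or -1. *)
Lemma psi_not_constant e y : ~ (forall t, 0 <= t <= len e -> psi (epar e t) = y).
Proof.
move=> const; have l0 := len_gt0 e.
have he : (e, false) \in half_edges (dpar (e, false) 0 : gpoint H).
  by apply: half_edges_dpar; rewrite lexx l0.
have [k kx kE] := isometry_germ i_dist he.
have [g gc g1] := exists_unit_slope_model card_ge val2 kx.
have gE s : 0 <= s <= len e -> g (i (epar e s)) = g (i (epar e 0)).
  by move=> hs; apply: psi_canonical => //; rewrite !const// lexx ltW.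
have {}g1 : germ_affine (g \o i) (dpar (e, false) 0) (e, false) 1 \/
            germ_affine (g \o i) (dpar (e, false) 0) (e, false) (-1).
  by case: g1 => g1; [left|right]; exact: isometry_germ_affine kE g1.
by case: g1 => /(near0_pick l0)[s [s0 sl]];
  rewrite ray_dpar pos_dpar ?lexx//= add0r /dpar /= gE; lra.
Qed.

Lemma edge_lift e : deg e = 1%N /\ exists h' : edge H' * bool, len h'.1 = len e /\
  forall t, 0 <= t <= len e -> psi (epar e t) = dpar h' t.
Proof.
have l0 := len_gt0 e.
case: (psi_dilation e) => [[_ [y yE]]|[e' [b [c cE]]]]; first by case: (psi_not_constant yE).
(* Orienting the target edge by the sign of the dilation makes the coordinate along [h']
   nondecreasing, starting from [p]. *)
pose h' := (e', b); pose p := if b then len e' - c else c.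
have {cE} cE t : 0 <= t <= len e ->
    0 <= p + (deg e)%:R * t <= len h'.1 /\ psi (epar e t) = dpar h' (p + (deg e)%:R * t).
  move=> ht; have := cE t ht; rewrite /p /dpar /=; case: b {h' p cE} => /= -[ct ->].
    by rewrite expr1 in ct *; split; [|congr epar]; lra.
  by rewrite expr0 in ct *; split; [|congr epar]; lra.
have [deg0|deg0] := posnP (deg e).
  case: (@psi_not_constant e (psi (epar e 0))) => t ht.
  by rewrite (cE t ht).2 (cE 0 _).2 ?deg0 ?mul0r// lexx ltW.
have degR : 1 <= (deg e)%:R :> R by rewrite ler1n.
have deg_pos : 0 < (deg e)%:R :> R by lra.
have [c0 E0] := cE 0 ltac:(lra); have [c1 E1] := cE (len e) ltac:(lra).
have dl : 0 < (deg e)%:R * len e by rewrite mulr_gt0.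
rewrite mulr0 addr0 in c0 E0.
have p0 : 0 <= p < len h'.1 by lra.
have deg1 : deg e = 1%N.
  (* Near the start the edge is stretched by the factor [deg e], while [psi] does not increase
     distances. *)
  apply/eqP; rewrite eqn_leq deg0 andbT -(ler_nat R).
  have r0 := star_radius_gt0 (dpar h' p).
  pose s := Num.min (len e) (star_radius (dpar h' p) / (deg e)%:R).
  have s0 : 0 < s by rewrite lt_min l0 divr_gt0.
  have s1 : s <= len e by rewrite ge_min lexx.
  have s2 : s <= star_radius (dpar h' p) / (deg e)%:R by rewrite ge_min lexx orbT.
  rewrite ler_pdivlMr// in s2.
  have ds : 0 < (deg e)%:R * s by rewrite mulr_gt0.
  have := psi_lipschitz (epar e 0) (epar e s).
  rewrite E0 (cE s _).2; last by lra.
  have := gdist_base_ray (half_edges_dpar p0) (s := (deg e)%:R * s).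
  rewrite ray_dpar pos_dpar// => ->; last by lra.
  have := @gdist_dpar _ H (e, false) 0 s; rewrite /dpar /= sub0r normrN ger0_norm; last exact: ltW.
  move=> d1 d2; have d3 : (deg e)%:R * s <= s.
    by apply: le_trans d2 (d1 _ _); lra.
  by rewrite -(ler_pM2r s0) mul1r.
split=> //; exists h'; rewrite deg1 mul1r in c1 E1 cE dl.
(* Both ends of [e] go to vertices, so the image begins and finishes at the ends of [h']. *)
have pz : p = 0.
  have [v' vE] := psi_vertex (src e).
  move: E0; rewrite epar0 vE => /esym /dpar_vertex[]; [lra|by []|lra].
have lE : len h'.1 = len e.
  have [v' vE] := psi_vertex (tgt e).
  by move: E1; rewrite epar1 vE pz add0r => /esym /dpar_vertex[]; lra.
by split=> // t ht; rewrite (cE t ht).2 mul1r pz add0r.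
Qed.

Lemma dart_lift : exists Psi : edge H * bool -> edge H' * bool,
  [/\ forall h, Psi (rev h) = rev (Psi h), forall h, len (Psi h).1 = len h.1 &
      forall h t, 0 <= t <= len h.1 -> psi (dpar h t) = dpar (Psi h) t].
Proof.
have [P PE] := choice (fun e => (edge_lift e).2).
exists (fun h => if h.2 then rev (P h.1) else P h.1); split.
- by case=> e [] /=; rewrite ?revK.
- by case=> e [] /=; exact: (PE e).1.
- case=> e [] t /= ht; last exact: (PE e).2.
  rewrite /dpar /= (PE e).2; last by lra.
  by rewrite -/(dpar (rev (P e)) t) dpar_rev (PE e).1.
Qed.

Lemma half_edge_maps_lift (Psi : edge H * bool -> edge H' * bool) v h h' :
  (forall h, len (Psi h).1 = len h.1) ->
  (forall h t, 0 <= t <= len h.1 -> psi (dpar h t) = dpar (Psi h) t) ->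
  tail h = v -> psi (inl v) = inl (tail h') ->
  half_edge_maps psi (inl v) h h' <-> Psi h = h'.
Proof.
move=> Plen PE hv hv'; have l0 := len_gt0 h.1; have l0' := len_gt0 h'.1; split.
  move=> [c c0]; rewrite hv'.
  (* It ensures [s * (c + 1) < len h.1], which excludes that [h'] is the reverse of [Psi h]. *)
  pose m := Num.min (len h.1) (Num.min (len h.1) (len h'.1) / (c + 1)).
  have m0' : 0 < Num.min (len h.1) (len h'.1) by rewrite lt_min l0.
  have m0 : 0 < m by rewrite lt_min l0 divr_gt0//; lra.
  have m1 : m <= len h.1 by rewrite ge_min lexx.
  have m2 : m <= Num.min (len h.1) (len h'.1) / (c + 1) by rewrite ge_min lexx orbT.
  rewrite ler_pdivlMr in m2; last by lra.
  have m3 : Num.min (len h.1) (len h'.1) <= len h.1 by rewrite ge_min lexx.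
  have m4 : Num.min (len h.1) (len h'.1) <= len h'.1 by rewrite ge_min lexx orbT.
  move=> /(near0_pick m0)[s [s0 sm]].
  have sc : s * (c + 1) < m * (c + 1) by rewrite ltr_pM2r//; lra.
  have {sc m2} sc := lt_le_trans sc m2.
  have cs : 0 < c * s by rewrite mulr_gt0.
  rewrite !ray_dpar /pos !add0r PE; last by lra.
  case/dpar_inj; [rewrite Plen; lra|lra|by case|].
  move=> [_]; rewrite Plen => E; have := lt_le_trans sc m3.
  by rewrite mulrDr mulr1 (mulrC s) E subrK ltxx.
move=> <-; exists 1 => //; apply/near0E; exists (len h.1) => // s s0 sl.
rewrite mul1r -hv -[inl (tail h)]dpar0 PE; last by rewrite lexx ltW.
rewrite !dpar0 !ray_dpar /pos !add0r PE//; lra.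
Qed.

(** All degrees being one, the sum in [harmonic_at] counts the fiber. *)
Lemma fiber_at_harmonic (Psi : edge H * bool -> edge H' * bool) v h1 h2 :
  (forall h, len (Psi h).1 = len h.1) ->
  (forall h t, 0 <= t <= len h.1 -> psi (dpar h t) = dpar (Psi h) t) ->
  psi (inl v) = inl (tail h1) -> psi (inl v) = inl (tail h2) ->
  #|fiber_at Psi v h1| = #|fiber_at Psi v h2|.
Proof.
move=> Plen PE v1 v2; have [k kE] := psi_harmonic (inl v).
have cnt h' : psi (inl v) = inl (tail h') -> #|fiber_at Psi v h'| = k.
  move=> hv'; rewrite -(kE h'); last by rewrite hv' in_half_edges_vertex.
  rewrite -sum1_card; under [RHS]eq_bigr do rewrite (edge_lift _).1.
  apply: eq_bigl => h; rewrite inE in_half_edges_vertex.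
  case: eqP => //= hv; apply/eqP/asboolP => hh.
    exact/(half_edge_maps_lift Plen PE hv hv').
  exact/(half_edge_maps_lift Plen PE hv hv').
by rewrite (cnt h1)// (cnt h2).
Qed.

Lemma harmonic_injective : injective phi.
Proof.
move=> x y xy; apply: contrapT => nxy.
have [Psi [Prev Plen PE]] := dart_lift.
have Pfib v h1 h2 := @fiber_at_harmonic Psi v h1 h2 Plen PE.
have inhab (z : gpoint H) : exists h, h \in half_edges z.
  apply/set0Pn; rewrite -card_gt0 -/(valence z) -(isometry_valence i_dist i_surj).
  exact: leq_trans (val2 _).
have [x0 x0E] := i_surj x; have [y0 y0E] := i_surj y.
have [h' h'2] : exists h', (2 <= #|[set h | Psi h == h']%SET|)%N.
  apply: (not_injective_fiber2 Prev Plen PE Pfib inhab (x := x0) (y := y0)).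
    by apply: i'_inj; rewrite !psiE x0E y0E.
  by move=> E; apply: nxy; rewrite -x0E -y0E E.
(* A single fiber with two elements suffices, as all fibers have the same size. *)
have two h : exists k, k <> h /\ Psi k = Psi h.
  have : ~~ ([set k | Psi k == Psi h] \subset [set h])%SET.
    apply/negP => /subset_leq_card; rewrite cards1.
    by rewrite (card_fiber_const Prev PE Pfib _ h') leqNgt h'2.
  by case/fintype.subsetPn => k; rewrite !inE => /eqP kE /eqP kh; exists k.
(* Folding is excluded on a reduced model [Gr], whose vertices differ from those of [H]; [lifts]
   matches germs of the two along the isometry [eta]. *)
have [Gr [theta [td ts v3 cge]]] := exists_reduced_model card_ge val2.
pose eta := theta \o i.
have ed a b : gdist (eta a) (eta b) = gdist a b by rewrite /eta /= td i_dist.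
have es b : exists a, eta a = b.
  by have [c <-] := ts b; have [a <-] := i_surj c; exists a.
have ei := isometry_inj ed.
pose lifts a h a0 h0 := [/\ eta a0 = a, h0 \in half_edges a0, h \in half_edges a &
  \forall s \near 0^'+, eta (ray a0 h0 s) = ray a h s].
have lift_at a0 h : h \in half_edges (eta a0) -> exists h0, lifts (eta a0) h a0 h0.
  have [sigma [sE _ E]] := isometry_half_edges ed es a0.
  rewrite E => /imsetP[h0 h0a hE]; exists h0; split=> //.
    by rewrite E hE imset_f.
  by rewrite hE; exact: sE.
have push a0 h0 : h0 \in half_edges a0 -> exists h, lifts (eta a0) h a0 h0.
  by move=> ha; have [h hx hE] := isometry_germ ed ha; exists h.
have lifts_neq a h a0 h0 b k b0 k0 : lifts a h a0 h0 -> lifts b k b0 k0 ->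
    (a0, h0) <> (b0, k0) -> (a, h) <> (b, k).
  move=> [<- ha0 ha hE] [<- kb0 kb kE] ne E; apply: ne.
  move: E => /pair_equal_spec[/ei ab hk]; subst b0 k.
  have [|_ ->//] := germ_inj ha0 kb0; near=> s; apply: ei.
  by rewrite (near hE s)// (near kE s).
pose T a h b k := exists a0 h0 b0 k0, [/\ lifts a h a0 h0, lifts b k b0 k0 &
  \forall s \near 0^'+, psi (ray a0 h0 s) = psi (ray b0 k0 s)].
apply: (@folding_false _ Gr v3 T) => //.
- by move=> a h b k [a0 [h0 [b0 [k0 [_ [_ _ kb _] _]]]]].
- move=> a h b k g [a0 [h0 [b0 [k0 [[_ _ _ hE] [_ _ _ kE] E]]]]] gc.
  have gtc := isometry_canonical_function td ts gc.
  near=> s; rewrite -(near hE s)// -(near kE s)//.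
  by apply: (@psi_canonical _ _ (g \o theta)) => //; near: s.
- move=> a h ha; have [a0 a0E] := es a; rewrite -a0E in ha *.
  have [h0 hl] := lift_at _ _ ha; have [_ h0a _ _] := hl.
  have [k0 [kh kE]] := two h0.
  have lk : len k0.1 = len h0.1 by rewrite -!Plen kE.
  have p0 := pos_ge0 h0a; have pl := pos_lt h0a.
  have kp : 0 <= pos a0 h0 < len k0.1 by rewrite lk p0 pl.
  have [k kl] := push _ _ (half_edges_dpar kp).
  (* The partner germ starts on [k0] at the coordinate that [a0] has on [h0]. *)
  exists (eta (dpar k0 (pos a0 h0))), k; split.
    exists a0, h0, (dpar k0 (pos a0 h0)), k0; split=> //.
    apply/near0E; exists (len h0.1 - pos a0 h0); first by lra.
    move=> s s0 sl; rewrite !ray_dpar pos_dpar// !PE ?kE//; lra.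
  by apply: (lifts_neq _ _ _ _ _ _ _ _ hl kl) => -[_ /esym].
- move=> a h b k h1 [a0 [h0 [b0 [k0 [hl kl E]]]]] ne h1a.
  have [aE h0a _ _] := hl; have [bE k0b _ _] := kl.
  have ne0 : (a0, h0) <> (b0, k0).
    move=> E0; apply: ne; move: E0 hl kl => [-> ->] [<- _ ha hE] [<- _ kb kE].
    have [|_ ->//] := germ_inj ha kb; near=> s.
    by rewrite -(near hE s)// -(near kE s).
  rewrite -aE in h1a; have [h10 h1l] := lift_at _ _ h1a.
  have [_ h10a _ _] := h1l.
  have [k10 [k10b kE ne1]] := lift_germ Prev Plen PE Pfib h0a k0b E ne0 h10a.
  have [k1 k1l] := push _ _ k10b; exists k1; rewrite -bE -aE; split.
    by exists a0, h10, b0, k10.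
  exact: lifts_neq h1l k1l ne1.
Unshelve. all: by end_near. Qed.

End HarmonicInjective.

Theorem corollary1p0p10 (R : realType) (G : wgraph R)
    (genus_ge3 : (3 <= genus G)%N)
    (no_valence1 : forall x : gpoint G, valence x <> 1%N)
    (n : nat) (f : 'I_n -> gpoint G -> \bar R)
    (f_min : minimal_generating_set (linear_system (canonical_divisor G)) f) :
  ~ injective (projective_map f) <->
  ~ is_harmonic [set: gpoint G]%classic (@mdist R (gpoint G))
      (range (projective_map f)) (image_dist f) (projective_map f).
Proof.
have card_ge := genus_card genus_ge3.
have val2 := valence_ge2 card_ge no_valence1.
have [F [-> F_can F_gen]] := minimal_generators_finite f_min.
suff : injective (projective_map (fun j => EFin \o F j)) <->
    is_harmonic [set: gpoint G]%classic (@mdist R (gpoint G))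
      (range (projective_map (fun j => EFin \o F j)))
      (image_dist (fun j => EFin \o F j)) (projective_map (fun j => EFin \o F j)).
  by case=> AB BA; split=> nA ?; apply: nA; [exact: BA|exact: AB].
split=> [inj|]; first exact: (injective_is_harmonic card_ge val2 F_can F_gen inj).
move=> [H [H' [i [i' [psi [deg [[ibij idist] [i'bij i'dist] psiE [_ pv _ pd] pharm]]]]]]].
have [_ i_inj i_surj] := ibij; have [_ i'_inj _] := i'bij.
apply: (@harmonic_injective _ G card_ge val2 n F F_can F_gen H H' i i' psi deg) => //.
- by move=> y; have [x _ <-] := i_surj y I; exists x.
- by move=> x y; apply: i'_inj; rewrite inE.
Qed.
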